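(* Let $X$ be a computable metric space and $x\in X$. Then $x$ is $1$-generic if and only if for every computable metric space $Y$, every limit computable $f:\subseteq X\to Y$ with $x\in\mathrm{dom}(f)$ is continuous at $x$.
   Context: $f:\subseteq X\to Y$ denotes a partial function; continuity of $f$ at $x\in\mathrm{dom}(f)$ refers to the subspace topology on $\mathrm{dom}(f)$. A computable metric space $(X,d,\alpha)$ is a metric space $(X,d)$ with a dense sequence $\alpha:\mathbb{N}\to X$ such that $d\circ(\alpha\times\alpha):\mathbb{N}^2\to\mathbb{R}$ is a computable (double) sequence of reals. It is represented by its Cauchy representation $\delta_X:\subseteq\mathbb{N}^{\mathbb{N}}\to X$, $\delta_X(p):=\lim_{n\to\infty}\alpha p(n)$ with $\mathrm{dom}(\delta_X)=\{p:(\forall k)(\forall n\geq k)\;d(\alpha p(n),\alpha p(k))<2^{-k}$ and $(\alpha p(n))_n$ converges$\}$. A function $f:\subseteq X\to Y$ between computable metric spaces is limit computable if it has a limit computable realizer, i.e. a limit computable $F:\subseteq\mathbb{N}^{\mathbb{N}}\to\mathbb{N}^{\mathbb{N}}$ with $\delta_YF(p)=f\delta_X(p)$ for all $p\in\mathrm{dom}(f\delta_X)$. A partial function $F:\subseteq\mathbb{N}^{\mathbb{N}}\to\mathbb{N}^{\mathbb{N}}$ is limit computable if there is a Turing machine with a two-way output tape (it may revise its output) that on each $p\in\mathrm{dom}(F)$ computes $F(p)$ such that each output position $n$ has, after finitely many steps, the content $F(p)(n)$ and is never changed again; nothing is required outside $\mathrm{dom}(F)$. In a computable metric space $(X,d,\alpha)$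 let $B_{\langle c,r\rangle}:=\{x\in X:d(x,\alpha(c))<\overline{r}\}$ for $c,r\in\mathbb{N}$, where $\langle\cdot,\cdot\rangle$ is the Cantor pairing and $\overline{\langle i,j,k\rangle}:=\frac{i-j}{k+1}$ encodes rationals via a standard triple coding. Let $W_i:=\{n\in\mathbb{N}:$ the $i$-th Turing machine halts on input $n\}$ and $U_i:=\bigcup_{n\in W_i}B_n$. The Turing jump of $X$ is $\mathsf{J}_X:X\to\mathbb{N}^{\mathbb{N}}$ with $\mathsf{J}_X(x)(i):=1$ if $x\in U_i$ and $\mathsf{J}_X(x)(i):=0$ otherwise. A point $x\in X$ is called $1$-generic if $\mathsf{J}_X$ is continuous at $x$ ($\mathbb{N}^{\mathbb{N}}$ with the product topology). *)

(* Defs.v *)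
From HB Require Import structures.
From Stdlib Require Cantor.
From mathcomp Require Import all_boot all_order all_algebra.
From mathcomp Require Import all_classical all_reals all_analysis.

Set Implicit Arguments.
Unset Strict Implicit.
Unset Printing Implicit Defensive.

Import Order.TTheory GRing.Theory Num.Theory.

(* Turing machines with a read-only input tape, finitely many work tapes and an
   output tape.  All tapes are one-way infinite; the input and output heads, like
   the work heads, can move both ways, so already written output can be revised. *)

(* Tape alphabet: the blank [None] and the two symbols [Some true], [Some false],
   written 1 and 0 in the comments below. *)
Definition symb : finType := option bool.

Inductive move := Left | Stay | Right.

Definition move_code (m : move) : option bool :=
  match m with Left => Some false | Stay => None | Right => Some true end.

Definition move_decode (c : option bool) : move :=
  match c with Some false => Left | None => Stay | Some true => Right end.

Lemma move_codeK : cancel move_code move_decode.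
Proof. by case. Qed.

HB.instance Definition _ := Finite.copy move (can_type move_codeK).

(* Transition table of a machine with [k] work tapes and states 0, ..., q.
   Argument: state and scanned symbols (input tape, work tapes, output tape).
   Value: new state, move of the input head, and for each of the other tapes the
   symbol written and the move; [None] means that the machine halts. *)
Definition tm_table (k q : nat) :=
  {ffun 'I_q.+1 * symb * k.-tuple symb * symb ->
        option ('I_q.+1 * move * k.-tuple (symb * move) * (symb * move))}.

Definition turing_machine := {kq : nat * nat & tm_table kq.1 kq.2}.

Definition work_tapes (M : turing_machine) : nat := (tag M).1.

Definition last_state (M : turing_machine) : nat := (tag M).2.

(* Gödel numbering: [pickle] is the explicit coding of finite data by numbers,
   [unpickle] its partial inverse; every machine has a number, and a number
   that codes no machine yields [None]. *)
Definition nth_machine (i : nat) : option turing_machine := unpickle i.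

Record tape := Tape { cells : nat -> symb; head : nat }.

Definition blank_tape : tape := Tape (fun=> None) 0.

Definition scanned (t : tape) : symb := cells t (head t).

(* A left move at the left end of a tape leaves the head where it is. *)
Definition move_head (m : move) (h : nat) : nat :=
  match m with Left => h.-1 | Stay => h | Right => h.+1 end.

Definition update_tape (t : tape) (a : symb * move) : tape :=
  Tape (fun j => if j == head t then a.1 else cells t j)
       (move_head a.2 (head t)).

Record config (M : turing_machine) := Config {
  state : 'I_(last_state M).+1;
  in_head : nat;
  work : 'I_(work_tapes M) -> tape;
  out : tape }.

Definition init_config (M : turing_machine) : config M :=
  @Config M ord0 0 (fun=> blank_tape) blank_tape.

Definition step (M : turing_machine) (input : nat -> symb) (c : config M) :
    option (config M) :=
  match tagged M (state c, input (in_head c),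
                  [tuple scanned (work c l) | l < work_tapes M],
                  scanned (out c)) with
  | Some (s, m, ws, o) =>
      Some (@Config M s (move_head m (in_head c))
              (fun l => update_tape (work c l) (tnth ws l))
              (update_tape (out c) o))
  | None => None
  end.

Definition run (M : turing_machine) (input : nat -> symb) (t : nat) : config M :=
  iter t (fun c => odflt c (step input c)) (init_config M).

Definition halts_at (M : turing_machine) (input : nat -> symb) (t : nat) : Prop :=
  step input (run M input t) = None.

(* The tape 1^n followed by blanks. *)
Definition nat_tape (n : nat) : nat -> symb :=
  fun j => if (j < n)%N then Some true else None.

(* The tape 1^(p 0) 0 1^(p 1) 0 1^(p 2) 0 ...: the n-th symbol 0 is in the cell
   with number (p 0 + 1) + ... + (p n + 1) - 1. *)
Definition baire_tape (p : nat -> nat) : nat -> symb :=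
  fun j => Some (~~ [exists n : 'I_j.+1, j.+1 == \sum_(i < n.+1) (p i).+1])%N.

Definition computable_nat (g : nat -> nat) : Prop :=
  exists M : turing_machine, forall n, exists2 t,
    halts_at M (nat_tape n) t &
    cells (out (run M (nat_tape n) t)) = nat_tape (g n).

Definition W (i : nat) : set nat :=
  [set n | exists2 M, nth_machine i = Some M & exists t, halts_at M (nat_tape n) t].

(* Limit computability of the partial function with domain [E] that agrees
   with [F] on [E]. *)
Definition limit_computable_baire (E : set (nat -> nat))
    (F : (nat -> nat) -> nat -> nat) : Prop :=
  exists M : turing_machine, forall p, E p -> forall n, exists t0, forall t,
    (t0 <= t)%N -> cells (out (run M (baire_tape p) t)) n = baire_tape (F p) n.

Local Open Scope classical_set_scope.
Local Open Scope ring_scope.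

Definition pair_code (n k : nat) : nat := Cantor.to_nat (n, k).

(* The rational coded by <i, j, k> := <i, <j, k>>. *)
Definition rat_of_code (R : realType) (r : nat) : R :=
  let: (i, jk) := Cantor.of_nat r in
  let: (j, k) := Cantor.of_nat jk in
  (i%:R - j%:R) / k.+1%:R.

Definition computable_double_seq (R : realType) (u : nat -> nat -> R) : Prop :=
  exists2 g, computable_nat g & forall n m k,
    `|u n m - rat_of_code R (g (pair_code n (pair_code m k)))| <= 2 ^- k.

Record computable_metric_space (R : realType) := ComputableMetricSpace {
  cms_carrier :> metricType R;
  cms_seq : nat -> cms_carrier;
  cms_dense : dense (range cms_seq);
  cms_computable :
    computable_double_seq (fun n m => mdist (cms_seq n) (cms_seq m)) }.

(* Graph of the Cauchy representation: p is in its domain and is mapped to x. *)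
Definition cauchy_name (R : realType) (X : computable_metric_space R)
    (p : nat -> nat) (x : X) : Prop :=
  (forall k n, (k <= n)%N ->
     mdist (cms_seq X (p n)) (cms_seq X (p k)) < 2 ^- k) /\
  (fun n => cms_seq X (p n)) @ \oo --> x.

(* The partial function with domain [D] that agrees with [f] on [D] is limit
   computable.  Since a computable metric space is nonempty, every partial
   function is of this form. *)
Definition limit_computable (R : realType) (X Y : computable_metric_space R)
    (D : set X) (f : X -> Y) : Prop :=
  exists (E : set (nat -> nat)) (F : (nat -> nat) -> nat -> nat),
    limit_computable_baire E F /\
    forall p x, cauchy_name p x -> D x -> E p /\ cauchy_name (F p) (f x).

(* B_<c,r> *)
Definition rational_ball (R : realType) (X : computable_metric_space R)
    (n : nat) : set X :=
  let: (c, r) := Cantor.of_nat n in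
  [set x | mdist x (cms_seq X c) < rat_of_code R r].

Arguments rational_ball {R} X n _.

(* U_i *)
Definition ce_open (R : realType) (X : computable_metric_space R) (i : nat) :
    set X :=
  \bigcup_(n in W i) rational_ball X n.

Arguments ce_open {R} X i _.

Definition turing_jump (R : realType) (X : computable_metric_space R) (x : X) :
    prod_topology (fun _ : nat => nat) :=
  fun i => if x \in ce_open X i then 1%N else 0%N.

Definition one_generic (R : realType) (X : computable_metric_space R) (x : X) :
    Prop :=
  {for x, continuous (@turing_jump R X)}.

(* Main.v *)
(* Write [U_i] for [ce_open X i].

   If [x] is not 1-generic, then the indicator function of some [U_i] is
   discontinuous at [x].  It is limit computable: a machine writes the constant
   name of 0 and, once it finds a ball of [U_i] that contains the input point,
   rewinds its output tape and writes the constant name of 1.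

   Conversely let [M] compute [f] in the limit.  By a Baire category argument
   there is a name [p] of [x] such that for every [L] some prefix of [p] forces
   the first [L] output cells: on no name of [x] extending it does [M] change
   them any more.  The points having a name that extends this prefix and on
   which [M] does change one of these cells form a c.e. open set [U_i] without
   [x], and it contains every nearby [y] in the domain with [f y] far from
   [f x].  By 1-genericity [U_i] misses a neighbourhood of [x], so [f] is
   continuous at [x].

   Machines are obtained by compiling a register language that implements the
   primitive recursive functions, and c.e. sets are handled as projections of
   primitive recursive predicates, runs of a fixed machine being primitive
   recursive. *)

From HB Require Import structures.
Require Import Defs.
From Stdlib Require Cantor.
From mathcomp Require Import all_boot all_order all_algebra.
From mathcomp Require Import zify ring lra.
From mathcomp Require Import all_classical all_reals all_analysis.

Set Implicit Arguments.
Unset Strict Implicit.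
Unset Printing Implicit Defensive.

Import Order.TTheory GRing.Theory Num.Theory.
Import Defs.

(** * Compiling register programs into Turing machines *)
From Stdlib Require Cantor.
From mathcomp Require Import all_boot all_order all_algebra.
From mathcomp Require Import zify lra.
From mathcomp Require Import all_classical all_reals all_analysis.

Set Implicit Arguments.
Unset Strict Implicit.
Unset Printing Implicit Defensive.

Import Order.TTheory GRing.Theory Num.Theory.
Import Defs.

(** In the converse, the fact that [M] settles on one name of [x] proves nothing about the other
    names: some that share a long prefix with it may still make [M] revise its output later. Then
    [x] itself would lie in the set of points with a late change, and genericity would give nothing.
    Category supplies a name for which this cannot happen. Nothing is known about [M] on names of
    points outside the domain, so the c.e. set has to be defined by finite runs alone, which make
    sense for every point. Openness of this set and the transfer of a prefix from [x] to its
    neighbours both need strict slack in the names; hence tight names.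

    On the machine side the decisive computations never halt, so a semantics by final stores does
    not suffice: an invariant of the output tape has to hold at every step, and the rounds of a loop
    have to be compared with machine time. *)

Definition upd (r : nat -> nat) (i v : nat) : nat -> nat :=
  fun j => if j == i then v else r j.

Inductive cmd :=
  | Inc of nat | Dec of nat | Seq of cmd & cmd | Ite of nat & cmd & cmd
  | While of nat & cmd | WhileIn of cmd | InRight | Out of symb & move.

Record store := Store { regs : nat -> nat; ihead : nat; otape : tape }.

Definition set_reg (s : store) (i v : nat) : store :=
  Store (upd (regs s) i v) (ihead s) (otape s).

(* [Q] is an invariant of the output tape that holds after every write; it
   controls the output of machines that never halt. *)
Inductive exec (Q : tape -> Prop) (inp : nat -> symb) : cmd -> store -> store -> Prop :=
  | ExecInc i s : exec Q inp (Inc i) s (set_reg s i (regs s i).+1)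
  | ExecDec i s : exec Q inp (Dec i) s (set_reg s i (regs s i).-1)
  | ExecSeq c d s1 s2 s3 :
      exec Q inp c s1 s2 -> exec Q inp d s2 s3 -> exec Q inp (Seq c d) s1 s3
  | ExecIteT i c d s s' : regs s i <> 0 -> exec Q inp c s s' ->
      exec Q inp (Ite i c d) s s'
  | ExecIteF i c d s s' : regs s i = 0 -> exec Q inp d s s' ->
      exec Q inp (Ite i c d) s s'
  | ExecWhileT i c s1 s2 s3 : regs s1 i <> 0 -> exec Q inp c s1 s2 ->
      exec Q inp (While i c) s2 s3 -> exec Q inp (While i c) s1 s3
  | ExecWhileF i c s : regs s i = 0 -> exec Q inp (While i c) s s
  | ExecWhileInT c s1 s2 s3 : inp (ihead s1) = Some true -> exec Q inp c s1 s2 ->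
      exec Q inp (WhileIn c) s2 s3 -> exec Q inp (WhileIn c) s1 s3
  | ExecWhileInF c s : inp (ihead s) <> Some true -> exec Q inp (WhileIn c) s s
  | ExecInRight s : exec Q inp InRight s (Store (regs s) (ihead s).+1 (otape s))
  | ExecOut a m s : Q (update_tape (otape s) (a, m)) ->
      exec Q inp (Out a m) s (Store (regs s) (ihead s) (update_tape (otape s) (a, m))).

Inductive instr :=
  | IInc of nat | IDec of nat | IJz of nat & nat | IJmp of nat
  | IIn of nat | IInRight | IOut of symb & move.

Fixpoint csize (c : cmd) : nat :=
  match c with
  | Seq c d => csize c + csize d
  | Ite _ c d => (csize c + csize d).+2
  | While _ c | WhileIn c => (csize c).+2
  | _ => 1
  end.

Fixpoint compile (a : nat) (c : cmd) : seq instr :=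
  match c with
  | Inc i => [:: IInc i]
  | Dec i => [:: IDec i]
  | Seq c d => compile a c ++ compile (a + csize c) d
  | Ite i c d => IJz i (a + csize c).+2 :: compile a.+1 c ++
      IJmp (a + csize c + csize d).+2 :: compile (a + csize c).+2 d
  | While i c => IJz i (a + csize c).+2 :: rcons (compile a.+1 c) (IJmp a)
  | WhileIn c => IIn (a + csize c).+2 :: rcons (compile a.+1 c) (IJmp a)
  | InRight => [:: IInRight]
  | Out s m => [:: IOut s m]
  end.

Lemma size_compile a c : size (compile a c) = csize c.
Proof.
elim: c a => //= [c IHc d IHd|i c IHc d IHd|i c IHc|c IHc] a.
- by rewrite size_cat IHc IHd.
- by rewrite size_cat /= IHc IHd addnS.
- by rewrite size_rcons IHc.
- by rewrite size_rcons IHc.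
Qed.

(** A jump target may equal [n], the address just past the program, where the machine halts. *)
Definition instr_ok (n K : nat) (x : instr) : bool :=
  match x with
  | IInc i | IDec i => i < K
  | IJz i a => (i < K) && (a <= n)
  | IJmp a | IIn a => a <= n
  | _ => true
  end.

Fixpoint reg_bound (c : cmd) : nat :=
  match c with
  | Inc i | Dec i => i.+1
  | Seq c d => maxn (reg_bound c) (reg_bound d)
  | Ite i c d => maxn i.+1 (maxn (reg_bound c) (reg_bound d))
  | While i c => maxn i.+1 (reg_bound c)
  | WhileIn c => reg_bound c
  | _ => 0
  end.

Lemma compile_ok a c n K : a + csize c <= n -> reg_bound c <= K ->
  all (instr_ok n K) (compile a c).
Proof.
elim: c a => //= [i|i|c IHc d IHd|i c IHc d IHd|i c IHc|c IHc] a.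
- by rewrite andbT.
- by rewrite andbT.
- rewrite geq_max all_cat => an /andP[cK dK].
  by rewrite IHc ?IHd //; lia.
- rewrite !geq_max all_cat /= => an /and3P[iK cK dK].
  by rewrite IHc ?IHd ?iK //; lia.
- rewrite !geq_max all_rcons /= => an /andP[iK cK].
  by rewrite IHc ?iK //; lia.
- rewrite all_rcons /= => an cK.
  by rewrite IHc //; lia.
Qed.

(* State 0 marks cell 0 of every work tape; state [pc.+1] executes instruction
   [pc]. Register [i] is the head position of work tape [i], and it is zero iff
   the scanned symbol is the mark. *)
Section Machine.
Variables (prog : seq instr) (K : nat).

Notation q := (size prog).+1.

Definition mark_zero (ws : K.-tuple symb) (i : nat) : bool :=
  [exists l : 'I_K, (l == i :> nat) && (tnth ws l == Some true)].

Definition next_pc (x : instr) (pc : nat) (a : symb) (ws : K.-tuple symb) : nat :=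
  match x with
  | IJz i b => if mark_zero ws i then b else pc.+1
  | IJmp b => b
  | IIn b => if a == Some true then pc.+1 else b
  | _ => pc.+1
  end.

Definition reg_move (x : instr) (l : nat) : move :=
  match x with
  | IInc i => if l == i then Right else Stay
  | IDec i => if l == i then Left else Stay
  | _ => Stay
  end.

Definition instr_table : tm_table K q :=
  [ffun x : 'I_q.+1 * symb * K.-tuple symb * symb => let: (s, a, ws, o) := x in
    if s == 0 :> nat then
      Some (inord 1, Stay, [tuple (Some true, Stay) | l < K], (o, Stay))
    else if onth prog s.-1 is Some i then
      Some (inord (next_pc i s.-1 a ws).+1,
            if i is IInRight then Right else Stay,
            [tuple (tnth ws l, reg_move i l) | l < K],
            if i is IOut b m then (b, m) else (o, Stay))
    else None].

Definition instr_machine : turing_machine :=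
  existT (fun kq : nat * nat => tm_table kq.1 kq.2) (K, q) instr_table.

Definition register_tape (v : nat) : tape :=
  Tape (fun j => if j == 0 then Some true else None) v.

Definition conf (pc : nat) (s : store) : config instr_machine :=
  @Config instr_machine (inord pc.+1 : 'I_q.+1) (ihead s)
    (fun l : 'I_K => register_tape (regs s l)) (otape s).

Lemma update_tape_scanned t m :
  update_tape t (scanned t, m) = Tape (cells t) (move_head m (head t)).
Proof.
by congr Tape; apply: funext => j; rewrite /scanned /=; case: eqP => [->|].
Qed.

Lemma mark_zeroE (r : nat -> nat) i : i < K ->
  mark_zero [tuple scanned (register_tape (r l)) | l < K] i = (r i == 0).
Proof.
move=> iK; apply/existsP/idP => [[l /andP[/eqP <-]]|ri0].
  by rewrite tnth_mktuple /scanned /=; case: ifP.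
by exists (Ordinal iK); rewrite eqxx tnth_mktuple /scanned /= ri0.
Qed.

Definition instr_store (x : instr) (s : store) : store :=
  match x with
  | IInc i => set_reg s i (regs s i).+1
  | IDec i => set_reg s i (regs s i).-1
  | IInRight => Store (regs s) (ihead s).+1 (otape s)
  | IOut a m => Store (regs s) (ihead s) (update_tape (otape s) (a, m))
  | _ => s
  end.

Definition instr_next (x : instr) (pc : nat) (inp : nat -> symb) (s : store) : nat :=
  match x with
  | IJz i b => if regs s i == 0 then b else pc.+1
  | IJmp b => b
  | IIn b => if inp (ihead s) == Some true then pc.+1 else b
  | _ => pc.+1
  end.

Hypothesis prog_ok : all (instr_ok (size prog) K) prog.

Lemma onth_lt (T : Type) (s : seq T) n x : onth s n = Some x -> n < size s.
Proof. by elim: s n => [|y s IH] [|n] //= /IH. Qed.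

Lemma onth_all (T : Type) (P : pred T) (s : seq T) n x :
  onth s n = Some x -> all P s -> P x.
Proof. by elim: s n => [|y s IH] [|n] //= => [[->] /andP[]|/IH H /andP[_ /H]]. Qed.

Lemma step_conf inp pc s x : onth prog pc = Some x ->
  step inp (conf pc s) = Some (conf (instr_next x pc inp s) (instr_store x s)).
Proof.
move=> px; have pcn := onth_lt px; have xok := onth_all px prog_ok.
rewrite /step /= /instr_table ffunE /= inordK ?ltnS ?(ltnW pcn) //= px.
congr Some; rewrite /conf; congr Config.
- congr (inord _.+1); case: x px xok => //= i b px /andP[iK _].
  by rewrite mark_zeroE.
- by case: x px xok.
- apply: funext => l; rewrite tnth_mktuple tnth_mktuple update_tape_scanned.
  congr Tape; rewrite /=.
  by case: x px xok => //= i _ _; rewrite /upd; case: eqP => [->|].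
- case: x px xok => *; rewrite ?update_tape_scanned //=; by case: (otape s).
Qed.

Lemma step_conf_halt inp s : step inp (conf (size prog) s) = None.
Proof.
rewrite /step /= /instr_table ffunE /= inordK ?ltnS //=.
by have -> : onth prog (size prog) = None by elim: prog.
Qed.

Lemma run_init inp : run instr_machine inp 1 = conf 0 (Store (fun=> 0) 0 blank_tape).
Proof.
rewrite /run /= /step /= /instr_table ffunE /= /conf; congr Config => //=.
  apply: funext => l; rewrite tnth_mktuple /register_tape /update_tape /=.
  by congr Tape.
by rewrite /update_tape /blank_tape /=; congr Tape; apply: funext => j; case: ifP.
Qed.

Inductive reach (Q : tape -> Prop) (inp : nat -> symb) :
    nat -> nat -> store -> nat -> store -> Prop :=
  | Reach0 pc s : reach Q inp 0 pc s pc s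
  | ReachS n pc s x pc' s' : onth prog pc = Some x -> Q (otape (instr_store x s)) ->
      reach Q inp n (instr_next x pc inp s) (instr_store x s) pc' s' ->
      reach Q inp n.+1 pc s pc' s'.

Lemma reach_trans Q inp n1 n2 pc1 s1 pc2 s2 pc3 s3 :
  reach Q inp n1 pc1 s1 pc2 s2 -> reach Q inp n2 pc2 s2 pc3 s3 ->
  reach Q inp (n1 + n2) pc1 s1 pc3 s3.
Proof.
elim=> // n pc s x pc' s' px Qx _ IH H; rewrite addSn.
by apply: ReachS px Qx _; exact: IH.
Qed.

Lemma reach1 Q inp pc s x : onth prog pc = Some x -> Q (otape (instr_store x s)) ->
  reach Q inp 1 pc s (instr_next x pc inp s) (instr_store x s).
Proof. by move=> px Qx; apply: ReachS px Qx _; exact: Reach0. Qed.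

Lemma reach_run Q inp n pc s pc' s' t : reach Q inp n pc s pc' s' ->
  run instr_machine inp t = conf pc s -> Q (otape s) ->
  run instr_machine inp (t + n) = conf pc' s' /\
  forall u, t <= u <= t + n -> Q (out (run instr_machine inp u)).
Proof.
move=> H; elim: H t => {n pc s pc' s'} [pc s|n pc s x pc' s' px Qx _ IH] t rt Qs.
  by rewrite addn0; split=> // u; rewrite -eqn_leq => /eqP <-; rewrite rt.
have rt1 : run instr_machine inp t.+1 = conf (instr_next x pc inp s) (instr_store x s).
  by rewrite /run iterS -/(run _ _ _) rt (step_conf _ _ px).
have [r1 r2] := IH _ rt1 Qx; rewrite addnS -addSn; split=> // u /andP[].
rewrite leq_eqVlt => /orP[/eqP <- _|tu un]; first by rewrite rt.
by apply: r2; rewrite tu.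
Qed.

Definition code_at (pc : nat) (p : seq instr) : Prop :=
  forall i x, onth p i = Some x -> onth prog (pc + i) = Some x.

Lemma onth_cat_l (T : Type) (s1 s2 : seq T) i x : onth s1 i = Some x ->
  onth (s1 ++ s2) i = Some x.
Proof. by elim: s1 i => [|y s1 IH] [|i] //= /IH. Qed.

Lemma onth_cat_r (T : Type) (s1 s2 : seq T) i :
  onth (s1 ++ s2) (size s1 + i) = onth s2 i.
Proof. by elim: s1. Qed.

Lemma code_at_cat pc p1 p2 : code_at pc (p1 ++ p2) ->
  code_at pc p1 /\ code_at (pc + size p1) p2.
Proof.
move=> H; split=> i x ix; first by apply: H; exact: onth_cat_l.
by rewrite -addnA; apply: H; rewrite onth_cat_r.
Qed.

Lemma code_at_cons pc x p : code_at pc (x :: p) ->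
  onth prog pc = Some x /\ code_at pc.+1 p.
Proof.
move=> H; split; first by rewrite -[pc]addn0; apply: H.
by move=> i y iy; rewrite addSnnS; apply: H.
Qed.

Lemma exec_reach Q inp c s s' : exec Q inp c s s' ->
  forall pc, code_at pc (compile pc c) -> Q (otape s) ->
  (exists n, reach Q inp n pc s (pc + csize c) s') /\ Q (otape s').
Proof.
elim=> {c s s'} /=.
- move=> i s pc /code_at_cons[px _] Qs; split=> //.
  by exists 1; rewrite addn1; exact: (reach1 _ px).
- move=> i s pc /code_at_cons[px _] Qs; split=> //.
  by exists 1; rewrite addn1; exact: (reach1 _ px).
- move=> c d s1 s2 s3 _ IH1 _ IH2 pc /code_at_cat[]; rewrite size_compile => H1 H2 Qs.
  have [[n1 R1] Q2] := IH1 _ H1 Qs; have [[n2 R2] Q3] := IH2 _ H2 Q2.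
  by split=> //; exists (n1 + n2); rewrite addnA; exact: reach_trans R1 R2.
- move=> i c d s s' si _ IH pc /code_at_cons[px /code_at_cat[H1]].
  rewrite size_compile => /code_at_cons[pj _] Qs.
  have [[n R] Q'] := IH _ H1 Qs; split=> //; exists (1 + (n + 1)).
  apply: reach_trans (reach1 inp px _) _ => //=; rewrite ifN; last exact/eqP.
  apply: reach_trans R _.
  by rewrite !addnS addnA; exact: (reach1 inp pj).
- move=> i c d s s' si _ IH pc /code_at_cons[px /code_at_cat[_]].
  rewrite size_compile => /code_at_cons[_]; rewrite -addSn => H2 Qs.
  have [[n R] Q'] := IH _ H2 Qs; split=> //; exists (1 + n).
  apply: reach_trans (reach1 inp px _) _ => //=; rewrite si eqxx.
  by rewrite !addnS addnA; exact: R.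
- move=> i c s1 s2 s3 si _ IH1 _ IH2 pc H Qs.
  have := H; rewrite -cats1 => /code_at_cons[px /code_at_cat[H1]].
  rewrite size_compile => /code_at_cons[pj _].
  have [[n1 R1] Q2] := IH1 _ H1 Qs; have [[n2 R2] Q3] := IH2 _ H Q2.
  split=> //; exists (1 + (n1 + (1 + n2))).
  apply: reach_trans (reach1 inp px _) _ => //=; rewrite ifN; last exact/eqP.
  apply: reach_trans R1 _; exact: (reach_trans (reach1 inp pj _) R2).
- move=> i c s si pc /code_at_cons[px _] Qs; split=> //; exists 1.
  have := reach1 (Q := Q) inp px Qs.
  by rewrite /= si eqxx !addnS.
- move=> c s1 s2 s3 si _ IH1 _ IH2 pc H Qs.
  have := H; rewrite -cats1 => /code_at_cons[px /code_at_cat[H1]].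
  rewrite size_compile => /code_at_cons[pj _].
  have [[n1 R1] Q2] := IH1 _ H1 Qs; have [[n2 R2] Q3] := IH2 _ H Q2.
  split=> //; exists (1 + (n1 + (1 + n2))).
  apply: reach_trans (reach1 inp px _) _ => //=; rewrite si eqxx.
  apply: reach_trans R1 _; exact: (reach_trans (reach1 inp pj _) R2).
- move=> c s si pc /code_at_cons[px _] Qs; split=> //; exists 1.
  have := reach1 (Q := Q) inp px Qs.
  by rewrite /= ifN ?addnS //; exact/eqP.
- move=> s pc /code_at_cons[px _] Qs; split=> //; exists 1; rewrite addn1.
  exact: (reach1 inp px).
- move=> a m s Qs pc /code_at_cons[px _] _; split=> //; exists 1; rewrite addn1.
  exact: (reach1 inp px).
Qed.

End Machine.

(** A round costs at least one machine step, so enough rounds pass any given time; this is how a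
    loop that never ends is followed. *)
Lemma loop_reach (prog : seq instr) Q inp i c (s_ : nat -> store) pc J :
  code_at prog pc (compile pc (While i c)) ->
  (forall j, regs (s_ j) i <> 0) ->
  (forall j, j < J -> exec Q inp c (s_ j) (s_ j.+1)) -> Q (otape (s_ 0)) ->
  exists n, [/\ J <= n, reach prog Q inp n pc (s_ 0) pc (s_ J) & Q (otape (s_ J))].
Proof.
move=> H si; elim: J => [|J IH] Hc Q0; first by exists 0; split=> //; exact: Reach0.
have [j jJ|n [Jn R QJ]] := IH _ Q0; first by apply: Hc; exact: ltnW.
have := H; rewrite /= -cats1 => /code_at_cons[px /code_at_cat[H1]].
rewrite size_compile => /code_at_cons[pj _].
have [[m Rm] QJ1] := exec_reach (Hc J (ltnSn J)) H1 QJ.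
exists (n + (1 + (m + 1))); split=> //; first by lia.
apply: reach_trans R _; apply: reach_trans (reach1 inp px _) _ => //=.
rewrite ifN; last exact/eqP.
by apply: reach_trans Rm _; exact: (reach1 inp pj).
Qed.

Lemma code_at0 p : code_at p 0 p.
Proof. by []. Qed.

Definition machine_of (c : cmd) : turing_machine :=
  instr_machine (compile 0 c) (reg_bound c).

Definition init_store : store := Store (fun=> 0) 0 blank_tape.

Lemma machine_of_ok c : all (instr_ok (size (compile 0 c)) (reg_bound c)) (compile 0 c).
Proof. by apply: compile_ok; rewrite // size_compile. Qed.

Lemma exec_halts inp c s : exec (fun=> True) inp c init_store s ->
  exists t, halts_at (machine_of c) inp t /\ out (run (machine_of c) inp t) = otape s.
Proof.
move=> H.
have [[n R] _] := exec_reach H (@code_at0 (compile 0 c)) I.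
have [r _] := reach_run (machine_of_ok c) R (run_init _ _ _) I.
exists (1 + n); rewrite /halts_at r; split => //.
by rewrite add0n -(size_compile 0) step_conf_halt.
Qed.

(** Quantifying over all programs that contain the code of [c], and over the starting time, makes
    the notion compose with [Seq] even though a diverging [c] has no [exec] derivation. *)
Definition eventually_out (Q : tape -> Prop) inp c s :=
  forall prog K pc t, all (instr_ok (size prog) K) prog ->
    code_at prog pc (compile pc c) -> run (instr_machine prog K) inp t = conf prog K pc s ->
    exists t0, forall u, t0 <= u -> Q (out (run (instr_machine prog K) inp u)).

Lemma eventually_out_run Q inp c : eventually_out Q inp c init_store ->
  exists t0, forall u, t0 <= u -> Q (out (run (machine_of c) inp u)).
Proof. by move=> H; exact: (H _ _ 0 1 (machine_of_ok c) (@code_at0 _) (run_init _ _ _)). Qed.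

Lemma eventually_out_seql Q inp c d s : eventually_out Q inp c s ->
  eventually_out Q inp (Seq c d) s.
Proof. by move=> H prog K pc t ok /= /code_at_cat[H1 _]; exact: H. Qed.

Lemma eventually_out_seqr Q inp c d s s' : exec (fun=> True) inp c s s' ->
  eventually_out Q inp d s' -> eventually_out Q inp (Seq c d) s.
Proof.
move=> cs H prog K pc t ok /= /code_at_cat[H1]; rewrite size_compile => H2 rt.
have [[n R] _] := exec_reach cs H1 I.
by have [r _] := reach_run ok R rt I; exact: H r.
Qed.

(** The first [J] rounds only have to run; [Q] is an invariant of the remaining ones. *)
Lemma eventually_out_loop Q inp i c (s_ : nat -> store) J :
  (forall j, regs (s_ j) i <> 0) ->
  (forall j, exec (fun=> True) inp c (s_ j) (s_ j.+1)) ->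
  (forall j, J <= j -> exec Q inp c (s_ j) (s_ j.+1)) -> Q (otape (s_ J)) ->
  eventually_out Q inp (While i c) (s_ 0).
Proof.
move=> si s_exec s_execQ QJ prog K pc t ok pcH rt.
have [n [_ R _]] := loop_reach (J := J) pcH si (fun j _ => s_exec j) I.
have [rJ _] := reach_run ok R rt I.
exists (t + n) => u tu.
(* [u] rounds after the [J]-th last at least [u] steps, so they cover time [u]. *)
have [j|j _|//|m [um R' _]] := @loop_reach _ Q inp i c (fun j => s_ (J + j)) pc u pcH.
- exact: si.
- by rewrite addnS; apply: s_execQ; rewrite leq_addr.
- by rewrite addn0.
rewrite addn0 in R'; have [_] := reach_run ok R' rJ QJ.
by apply; rewrite tu /=; lia.
Qed.

Lemma halts_run_const M inp t u : halts_at M inp t -> t <= u ->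
  run M inp u = run M inp t.
Proof.
move=> H /subnK <-; elim: (u - t) => [//|k IH].
by rewrite addSn /run iterS -/(run _ _ _) IH H.
Qed.

(** * Primitive recursive functions *)

Definition p1 (n : nat) : nat := (Cantor.of_nat n).1.
Definition p2 (n : nat) : nat := (Cantor.of_nat n).2.

Lemma p1K a b : p1 (pair_code a b) = a.
Proof. by rewrite /p1 /pair_code Cantor.cancel_of_to. Qed.

Lemma p2K a b : p2 (pair_code a b) = b.
Proof. by rewrite /p2 /pair_code Cantor.cancel_of_to. Qed.

Lemma pair_codeK n : pair_code (p1 n) (p2 n) = n.
Proof. by rewrite /pair_code /p1 /p2 -surjective_pairing Cantor.cancel_to_of. Qed.

Lemma of_natE n : Cantor.of_nat n = (p1 n, p2 n).
Proof. exact: surjective_pairing. Qed.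

Lemma p1_le n : p1 n <= n.
Proof.
have := Cantor.to_nat_non_decreasing (p1 n) (p2 n).
by rewrite -/(pair_code _ _) pair_codeK; lia.
Qed.

(** Unary functions fit programs with one argument register; with pairing, plain iteration already
    yields iteration with parameters ([prim_iterp]). *)
Inductive prim : (nat -> nat) -> Prop :=
  | prim_id : prim (fun n => n)
  | prim_zero : prim (fun=> 0)
  | prim_S : prim S
  | prim_p1 : prim p1
  | prim_p2 : prim p2
  | prim_comp f g : prim f -> prim g -> prim (fun n => f (g n))
  | prim_pair f g : prim f -> prim g -> prim (fun n => pair_code (f n) (g n))
  | prim_iter f : prim f -> prim (fun n => iter (p1 n) f (p2 n)).

(** The universal quantification over [Q], input and tapes records that such commands act on
    registers only, so they fit into any surrounding computation. *)
Definition runs (c : cmd) (r r' : nat -> nat) : Prop :=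
  forall Q inp h o, exec Q inp c (Store r h o) (Store r' h o).

Lemma runs_inc i r : runs (Inc i) r (upd r i (r i).+1).
Proof. by move=> *; exact: ExecInc. Qed.

Lemma runs_dec i r : runs (Dec i) r (upd r i (r i).-1).
Proof. by move=> *; exact: ExecDec. Qed.

Lemma runs_seq c d r1 r2 r3 : runs c r1 r2 -> runs d r2 r3 -> runs (Seq c d) r1 r3.
Proof. by move=> cr dr Q inp h o; exact: ExecSeq (cr _ _ _ _) (dr _ _ _ _). Qed.

Lemma runs_iteT i c d r r' : r i <> 0 -> runs c r r' -> runs (Ite i c d) r r'.
Proof. by move=> ri cr Q inp h o; exact: ExecIteT (cr _ _ _ _). Qed.

Lemma runs_iteF i c d r r' : r i = 0 -> runs d r r' -> runs (Ite i c d) r r'.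
Proof. by move=> ri cr Q inp h o; exact: ExecIteF (cr _ _ _ _). Qed.

Lemma runs_whileT i c r1 r2 r3 : r1 i <> 0 -> runs c r1 r2 ->
  runs (While i c) r2 r3 -> runs (While i c) r1 r3.
Proof. by move=> ri cr dr Q inp h o; exact: ExecWhileT (cr _ _ _ _) (dr _ _ _ _). Qed.

Lemma runs_whileF i c r : r i = 0 -> runs (While i c) r r.
Proof. by move=> ri Q inp h o; exact: ExecWhileF. Qed.

Lemma runs_eq c r r1 r2 : runs c r r1 -> r1 = r2 -> runs c r r2.
Proof. by move=> ? <-. Qed.

Lemma upd_same r i v : upd r i v i = v.
Proof. by rewrite /upd eqxx. Qed.

Ltac regs_eq := apply: funext => ?; rewrite /upd;
  repeat (case: eqP => ?); subst; try lia.

Ltac upd_simpl := rewrite /upd; repeat (case: eqP => ?); lia.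

Definition move_reg i j := While i (Seq (Dec i) (Inc j)).

Lemma runs_move_reg i j r : i <> j ->
  runs (move_reg i j) r (upd (upd r i 0) j (r j + r i)).
Proof.
move=> ij; move E : (r i) => n; elim: n r E => [|n IH] r E.
  apply: runs_eq; first exact: runs_whileF.
  by regs_eq.
apply: runs_whileT; first by rewrite E.
  exact: runs_seq (runs_dec _ _) (runs_inc _ _).
apply: runs_eq; first by apply: IH; upd_simpl.
by regs_eq.
Qed.

Definition move_reg2 i j k := While i (Seq (Dec i) (Seq (Inc j) (Inc k))).

Lemma runs_move_reg2 i j k r : i <> j -> i <> k -> j <> k ->
  runs (move_reg2 i j k) r (upd (upd (upd r i 0) j (r j + r i)) k (r k + r i)).
Proof.
move=> ij ik jk; move E : (r i) => n; elim: n r E => [|n IH] r E.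
  apply: runs_eq; first exact: runs_whileF.
  by regs_eq.
apply: runs_whileT; first by rewrite E.
  apply: runs_seq (runs_dec _ _) (runs_seq (runs_inc _ _) (runs_inc _ _)).
apply: runs_eq; first by apply: IH; upd_simpl.
by regs_eq.
Qed.

Definition clear_reg i := While i (Dec i).

Lemma runs_clear_reg i r : runs (clear_reg i) r (upd r i 0).
Proof.
move E : (r i) => n; elim: n r E => [|n IH] r E.
  apply: runs_eq; first exact: runs_whileF.
  by regs_eq.
apply: runs_whileT; [by rewrite E|exact: runs_dec|].
apply: runs_eq; first by apply: IH; upd_simpl.
by regs_eq.
Qed.

Definition copy_reg b := Seq (move_reg2 b b.+1 b.+2) (move_reg b.+2 b).

Lemma runs_copy_reg b r : r b.+1 = 0 -> r b.+2 = 0 ->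
  runs (copy_reg b) r (upd r b.+1 (r b)).
Proof.
move=> r1 r2; apply: runs_seq; first by apply: runs_move_reg2; lia.
apply: runs_eq; first by apply: runs_move_reg; lia.
by regs_eq.
Qed.

(** Triangular numbers in the form in which [Cantor.to_nat] computes them, so that [pair_codeE]
    holds by conversion. *)
Definition tri (n : nat) : nat := nat_rec _ 0 (fun i m => S i + m) n.

Lemma pair_codeE x y : pair_code x y = y + tri (y + x).
Proof. by []. Qed.

Definition tri_loop b := While b.+2
  (Seq (move_reg2 b.+2 b b.+1) (Seq (Dec b.+1) (move_reg b.+1 b.+2))).

Lemma runs_tri_loop b r : r b.+1 = 0 ->
  runs (tri_loop b) r (upd (upd r b (r b + tri (r b.+2))) b.+2 0).
Proof.
move E : (r b.+2) => n; elim: n r E => [|n IH] r E r1.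
  apply: runs_eq; first exact: runs_whileF.
  by rewrite addn0; regs_eq.
apply: runs_whileT; first by rewrite E.
  apply: runs_seq; first by apply: runs_move_reg2; lia.
  apply: runs_seq; first exact: runs_dec.
  by apply: runs_move_reg; lia.
apply: runs_eq; first by apply: IH; upd_simpl.
have -> : tri n.+1 = n.+1 + tri n by [].
by regs_eq.
Qed.

Definition pair_reg b := Seq (move_reg2 b.+1 b b.+2) (tri_loop b).

Lemma runs_pair_reg b r : r b = 0 ->
  runs (pair_reg b) r
    (upd (upd (upd r b (pair_code (r b.+2) (r b.+1))) b.+1 0) b.+2 0).
Proof.
move=> r0; apply: runs_seq; first by apply: runs_move_reg2; lia.
apply: runs_eq; first by apply: runs_tri_loop; upd_simpl.
have u2 v : upd v b.+2 (r b.+2 + r b.+1) b.+2 = r b.+1 + r b.+2.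
  by rewrite /upd eqxx addnC.
by rewrite pair_codeE u2; regs_eq.
Qed.

(** Counts [b] down while walking through Cantor's enumeration: [(x.+1, y)] is followed by
    [(x, y.+1)], and [(0, y)] by [(y.+1, 0)]. *)
Definition unpair_reg b := While b (Seq (Dec b) (Ite b.+1
  (Seq (Dec b.+1) (Inc b.+2)) (Seq (move_reg b.+2 b.+1) (Inc b.+1)))).

Lemma runs_unpair_loop b r n : r b.+1 = p1 n -> r b.+2 = p2 n ->
  runs (unpair_reg b) r
    (upd (upd (upd r b 0) b.+1 (p1 (n + r b))) b.+2 (p2 (n + r b))).
Proof.
move E : (r b) => m; elim: m r n E => [|m IH] r n E r1 r2.
  apply: runs_eq; first exact: runs_whileF.
  by rewrite addn0; regs_eq.
have nS : (p1 n.+1, p2 n.+1) =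
    match p1 n with x.+1 => (x, (p2 n).+1) | 0 => ((p2 n).+1, 0) end.
  by rewrite -of_natE /= -/(Cantor.of_nat n) of_natE.
rewrite addnS -addSn.
case: (p1 n) r1 nS => [|x] r1 [n1 n2].
  apply: runs_whileT; first by rewrite E.
    apply: runs_seq; first exact: runs_dec.
    apply: runs_iteF; first by upd_simpl.
    apply: runs_seq (runs_inc _ _); apply: runs_move_reg; lia.
  apply: runs_eq; first by apply: (IH _ n.+1); rewrite ?n1 ?n2; upd_simpl.
  by regs_eq.
apply: runs_whileT; first by rewrite E.
  apply: runs_seq; first exact: runs_dec.
  apply: runs_iteT; first by upd_simpl.
  apply: runs_seq (runs_dec _ _) (runs_inc _ _).
apply: runs_eq; first by apply: (IH _ n.+1); rewrite ?n1 ?n2; upd_simpl.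
by regs_eq.
Qed.

Lemma runs_unpair_reg b r : r b.+1 = 0 -> r b.+2 = 0 ->
  runs (unpair_reg b) r (upd (upd (upd r b 0) b.+1 (p1 (r b))) b.+2 (p2 (r b))).
Proof. by move=> r1 r2; exact: (@runs_unpair_loop b r 0). Qed.

(* Registers below [b] are preserved, so implementations can be nested. *)
Lemma prim_runs f : prim f -> forall b, exists c, forall r,
  (forall i, b < i -> r i = 0) -> runs c r (upd r b (f (r b))).
Proof.
elim=> {f}.
- move=> b; exists (Seq (Inc b) (Dec b)) => r r0.
  apply: runs_eq; first exact: runs_seq (runs_inc _ _) (runs_dec _ _).
  by regs_eq.
- by move=> b; exists (clear_reg b) => r r0; exact: runs_clear_reg.
- by move=> b; exists (Inc b) => r r0; exact: runs_inc.
- move=> b; exists (Seq (unpair_reg b) (Seq (move_reg b.+1 b) (clear_reg b.+2))) => r r0.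
  have r1 := r0 b.+1 (ltnSn _); have r2 := r0 b.+2 (leqW (ltnSn _)).
  apply: runs_seq; first exact: runs_unpair_reg.
  apply: runs_seq; first by apply: runs_move_reg; lia.
  apply: runs_eq; first exact: runs_clear_reg.
  by regs_eq.
- move=> b; exists (Seq (unpair_reg b) (Seq (move_reg b.+2 b) (clear_reg b.+1))) => r r0.
  have r1 := r0 b.+1 (ltnSn _); have r2 := r0 b.+2 (leqW (ltnSn _)).
  apply: runs_seq; first exact: runs_unpair_reg.
  apply: runs_seq; first by apply: runs_move_reg; lia.
  apply: runs_eq; first exact: runs_clear_reg.
  by regs_eq.
- move=> f g _ IHf _ IHg b; have [cf Hf] := IHf b; have [cg Hg] := IHg b.
  exists (Seq cg cf) => r r0; apply: runs_seq; first exact: Hg.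
  apply: runs_eq; first by apply: Hf => i bi; rewrite /upd gtn_eqF ?r0.
  by rewrite upd_same; regs_eq.
- move=> f g _ IHf _ IHg b; have [cf Hf] := IHf b.+2; have [cg Hg] := IHg b.+1.
  exists (Seq (copy_reg b) (Seq cg (Seq (move_reg b b.+2) (Seq cf (pair_reg b))))) => r r0.
  have r1 := r0 b.+1 (ltnSn _); have r2 := r0 b.+2 (leqW (ltnSn _)).
  apply: runs_seq; first exact: runs_copy_reg.
  apply: (@runs_seq _ _ _ (upd r b.+1 (g (r b)))).
    apply: runs_eq.
      by apply: Hg => i bi; rewrite /upd gtn_eqF ?r0 //; lia.
    by rewrite upd_same; regs_eq.
  apply: (@runs_seq _ _ _ (upd (upd (upd r b.+1 (g (r b))) b 0) b.+2 (r b))).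
    apply: runs_eq; first by apply: runs_move_reg; lia.
    by regs_eq.
  apply: (@runs_seq _ _ _ (upd (upd (upd r b.+1 (g (r b))) b 0) b.+2 (f (r b)))).
    apply: runs_eq.
      by apply: Hf => i bi; rewrite /upd !gtn_eqF ?r0 //; lia.
    by rewrite upd_same; regs_eq.
  apply: runs_eq; first by apply: runs_pair_reg; upd_simpl.
  rewrite upd_same (_ : upd _ b.+2 _ b.+1 = g (r b)); last by upd_simpl.
  by regs_eq.
- move=> f _ IHf b; have [cf Hf] := IHf b.+2.
  pose body := While b.+1 (Seq (Dec b.+1) cf).
  have bodyP n r : (forall i, b.+2 < i -> r i = 0) -> r b.+1 = n ->
      runs body r (upd (upd r b.+1 0) b.+2 (iter n f (r b.+2))).
    elim: n r => [|n IH] r r0 E.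
      apply: runs_eq; first exact: runs_whileF.
      by regs_eq.
    apply: runs_whileT; first by rewrite E.
      apply: runs_seq; first exact: runs_dec.
      by apply: Hf => i bi; rewrite /upd gtn_eqF ?r0 //; lia.
    apply: runs_eq.
      apply: IH; last by upd_simpl.
      by move=> i bi; rewrite /upd !gtn_eqF ?r0 //; lia.
    rewrite iterSr upd_same (_ : upd r b.+1 _ b.+2 = r b.+2); last by upd_simpl.
    by regs_eq.
  exists (Seq (unpair_reg b) (Seq body (move_reg b.+2 b))) => r r0.
  have r1 := r0 b.+1 (ltnSn _); have r2 := r0 b.+2 (leqW (ltnSn _)).
  apply: runs_seq; first exact: runs_unpair_reg.
  apply: runs_seq.
    apply: (bodyP (p1 (r b))); last by upd_simpl.
    by move=> i bi; rewrite /upd !gtn_eqF ?r0 //; lia.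
  apply: runs_eq; first by apply: runs_move_reg; lia.
  rewrite (_ : upd _ b.+2 (p2 (r b)) b.+2 = p2 (r b)); last by upd_simpl.
  by regs_eq.
Qed.

(** * Closure properties of the primitive recursive functions *)

Lemma prim_ext f g : prim f -> f =1 g -> prim g.
Proof. by move=> pf /funext <-. Qed.

Lemma prim_succ f : prim f -> prim (fun z => (f z).+1).
Proof. exact: prim_comp prim_S. Qed.

Lemma prim_const k : prim (fun=> k).
Proof. by elim: k => [|k IH]; [exact: prim_zero|exact: prim_succ IH]. Qed.

Lemma prim_p1c f : prim f -> prim (fun z => p1 (f z)).
Proof. exact: prim_comp prim_p1. Qed.

Lemma prim_p2c f : prim f -> prim (fun z => p2 (f z)).
Proof. exact: prim_comp prim_p2. Qed.

Lemma prim_app2 (G : nat -> nat -> nat) f g : prim (fun w => G (p1 w) (p2 w)) ->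
  prim f -> prim g -> prim (fun z => G (f z) (g z)).
Proof.
move=> pG pf pg; apply: prim_ext (prim_comp pG (prim_pair pf pg)) _ => z.
by rewrite p1K p2K.
Qed.

(* The parameter [z] is carried along as the first component of the state. *)
Lemma prim_iterp (F : nat -> nat -> nat) f g : prim (fun w => F (p1 w) (p2 w)) ->
  prim f -> prim g -> prim (fun z => iter (f z) (F z) (g z)).
Proof.
move=> pF pf pg; pose step w := pair_code (p1 w) (F (p1 w) (p2 w)).
have ps : prim step by exact: prim_pair prim_p1 pF.
apply: prim_ext (prim_p2c (prim_comp (prim_iter ps)
  (prim_pair pf (prim_pair prim_id pg)))) _ => z.
rewrite p1K p2K; elim: (f z) => [|n IH] /=; first by rewrite p2K.
rewrite {1}/step p2K IH; congr (F _ _).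
by elim: n {IH} => [|n IH] /=; rewrite ?p1K // /step p1K.
Qed.

Ltac prim_step := first [ assumption | exact: prim_id | simple apply prim_const
  | simple apply prim_p1c | simple apply prim_p2c | simple apply prim_pair
  | simple apply prim_succ | simple apply prim_iterp ].

Lemma prim_addn f g : prim f -> prim g -> prim (fun z => f z + g z).
Proof.
move=> pf pg; have: prim (fun z => iter (g z) S (f z)) by do !prim_step.
by move/prim_ext; apply=> z; elim: (g z) => [|n] /=; rewrite ?addn0 // addnS => ->.
Qed.

Lemma prim_pred f : prim f -> prim (fun z => (f z).-1).
Proof.
move=> pf.
(* The iterated state pairs the predecessor with the number reached so far. *)
have: prim (fun z => p1 (iter (f z) (fun w => pair_code (p2 w) (p2 w).+1) 0)).
  by do !prim_step.
move/prim_ext; apply=> z.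
suff -> : iter (f z) (fun w => pair_code (p2 w) (p2 w).+1) 0 =
    pair_code (f z).-1 (f z) by rewrite p1K.
by elim: (f z) => [//|n] /= ->; rewrite p2K.
Qed.

Lemma prim_subn f g : prim f -> prim g -> prim (fun z => f z - g z).
Proof.
move=> pf pg; have: prim (fun z => iter (g z) predn (f z)).
  by do ![simple apply prim_pred|prim_step].
by move/prim_ext; apply=> z; elim: (g z) => [|n] /=; rewrite ?subn0 // subnS => ->.
Qed.

Lemma prim_muln f g : prim f -> prim g -> prim (fun z => f z * g z).
Proof.
move=> pf pg; have: prim (fun z => iter (g z) (addn (f z)) 0).
  by do ![simple apply prim_addn|prim_step]; exact: prim_comp pf prim_p1.
by move/prim_ext; apply=> z; elim: (g z) => [|n] /=; rewrite ?muln0 // mulnS => ->.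
Qed.

Lemma prim_exp2 f : prim f -> prim (fun z => 2 ^ f z).
Proof.
move=> pf; have: prim (fun z => iter (f z) (muln 2) 1).
  by do ![simple apply prim_muln|prim_step].
by move/prim_ext; apply=> z; elim: (f z) => [//|n] /=; rewrite expnS => ->.
Qed.

Lemma prim_eq0 f : prim f -> prim (fun z => nat_of_bool (f z == 0)).
Proof.
move=> pf; have: prim (fun z => 1 - f z).
  by do ![simple apply prim_subn|prim_step].
by move/prim_ext; apply=> z; case: (f z).
Qed.

Lemma prim_neg (b : nat -> bool) : prim b -> prim (fun z => nat_of_bool (~~ b z)).
Proof. by move/prim_eq0/prim_ext; apply=> z; case: (b z). Qed.

Lemma prim_leq f g : prim f -> prim g -> prim (fun z => nat_of_bool (f z <= g z)).
Proof. by move=> pf pg; apply: prim_eq0; apply: prim_subn. Qed.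

Lemma prim_andb (b c : nat -> bool) : prim b -> prim c ->
  prim (fun z => nat_of_bool (b z && c z)).
Proof.
move=> pb pc; apply: prim_ext (prim_muln pb pc) _ => z.
by case: (b z); case: (c z).
Qed.

Lemma prim_eqn f g : prim f -> prim g -> prim (fun z => nat_of_bool (f z == g z)).
Proof.
move=> pf pg; apply: prim_ext (prim_andb (prim_leq pf pg) (prim_leq pg pf)) _ => z.
by rewrite -eqn_leq.
Qed.

Lemma prim_if (b : nat -> bool) f g : prim b -> prim f -> prim g ->
  prim (fun z => if b z then f z else g z).
Proof.
move=> pb pf pg; have: prim (fun z => iter (b z) (fun=> f z) (g z)).
  by do !prim_step; exact: prim_comp pf prim_p1.
by move/prim_ext; apply=> z; case: (b z).
Qed.

Ltac prim := repeat first [ prim_step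
  | simple apply prim_addn | simple apply prim_pred | simple apply prim_subn
  | simple apply prim_muln | simple apply prim_exp2 | simple apply prim_leq
  | simple apply prim_andb | simple apply prim_eqn | simple apply prim_if
  | simple apply prim_neg
  | match goal with
    | H : prim ?f |- prim (fun z => ?f _) => apply: (prim_comp H)
    | H : prim (fun w => ?G (p1 w) (p2 w)) |- prim (fun z => ?G _ _) =>
        apply: (prim_app2 H)
    end ].

(** * Computable functions, unbounded search and c.e. sets *)

Definition sig1 (P : nat -> Prop) : Prop :=
  exists2 f, prim f & forall n, P n <-> exists s, f (pair_code n s) <> 0.

Lemma exec_while_iter Q inp i c (s_ : nat -> store) m s' :
  (forall j, j < m -> regs (s_ j) i <> 0 /\ exec Q inp c (s_ j) (s_ j.+1)) ->
  exec Q inp (While i c) (s_ m) s' -> exec Q inp (While i c) (s_ 0) s'.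
Proof.
elim: m => [//|m IH] H Hm; apply: IH => [j jm|]; first by apply: H; exact: ltnW.
by have [? ?] := H m (ltnSn m); exact: ExecWhileT Hm.
Qed.

Definition read_nat i := WhileIn (Seq (Inc i) InRight).

Lemma exec_read_nat Q inp i r h o v :
  (forall j, j < v -> inp (h + j) = Some true) -> inp (h + v) <> Some true ->
  exec Q inp (read_nat i) (Store r h o) (Store (upd r i (r i + v)) (h + v) o).
Proof.
elim: v r h => [|v IH] r h iv; first rewrite !addn0 => iv0.
  have -> : upd r i (r i) = r by apply: funext => j; rewrite /upd; case: eqP => [->|].
  exact: ExecWhileInF.
move=> iv0; apply: ExecWhileInT.
- by have := iv 0; rewrite addn0; apply.
- exact: ExecSeq (ExecInc _ _ _ _) (ExecInRight _ _ _).
- have := IH (upd r i (r i).+1) h.+1.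
  rewrite upd_same !addSnnS; have -> : upd (upd r i (r i).+1) i (r i + v.+1) = upd r i (r i + v.+1).
    by apply: funext => j; rewrite /upd; case: eqP.
  by apply=> // j jv; rewrite addSnnS; apply: iv.
Qed.

Lemma nat_tape_read n : (forall j, j < n -> nat_tape n (0 + j) = Some true) /\
  nat_tape n (0 + n) <> Some true.
Proof. by rewrite /nat_tape; split=> [j ->|] //; rewrite ltnn. Qed.

Theorem prim_computable f : prim f -> computable_nat f.
Proof.
move=> /prim_runs /(_ 0)[c Hc].
pose prog := Seq (read_nat 0) (Seq c (While 0 (Seq (Dec 0) (Out (Some true) Right)))).
exists (machine_of prog) => n.
pose tp j := Tape (fun i => if i < j then Some true else None) j.
have H : exec (fun=> True) (nat_tape n) prog init_store
    (Store (upd (fun=> 0) 0 0) n (tp (f n))).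
  have [H1 H2] := nat_tape_read n.
  apply: ExecSeq; first exact: exec_read_nat H1 H2.
  rewrite add0n; apply: ExecSeq.
    by apply: Hc => i i0; rewrite /upd gtn_eqF.
  pose s_ j := Store (upd (fun=> 0) 0 (f n - j)) n (tp j).
  have -> : Store (upd (upd (fun=> 0) 0 n) 0 (f (upd (fun=> 0) 0 n 0))) n
      (otape init_store) = s_ 0.
    rewrite upd_same /s_ subn0; congr Store; first by apply: funext => j; rewrite /upd; case: eqP.
  apply: (@exec_while_iter _ _ _ _ s_ (f n)) => [j jn|].
    split; first by rewrite /s_ /= upd_same; lia.
    apply: ExecSeq; first exact: ExecDec.
    have -> : s_ j.+1 = Store (upd (upd (fun=> 0) 0 (f n - j)) 0 (f n - j).-1) n
        (update_tape (tp j) (Some true, Right)).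
      rewrite /s_; congr Store; first by rewrite subnS; apply: funext => i; rewrite /upd; case: eqP.
      rewrite /tp /update_tape /=; congr Tape; apply: funext => i.
      by rewrite ltnS [in LHS]leq_eqVlt; case: eqP.
    rewrite {1}/set_reg /= upd_same; exact: ExecOut.
  have -> : s_ (f n) = Store (upd (fun=> 0) 0 0) n (tp (f n)) by rewrite /s_ subnn.
  by apply: ExecWhileF; rewrite /= upd_same.
have [t [ht ot]] := exec_halts H.
by exists t; rewrite // ot.
Qed.

(** Register 0 is the loop flag, register 1 the position of the output head, kept for a later
    rewind, and register 2 holds the data of the search. *)
Definition rfile (a b c : nat) : nat -> nat := nth 0 [:: a; b; c].

Definition false_tape (m : nat) : tape :=
  Tape (fun j => if j < m then Some false else None) m.

Lemma update_false_tape m :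
  update_tape (false_tape m) (Some false, Right) = false_tape m.+1.
Proof.
rewrite /false_tape /update_tape /=; congr Tape; apply: funext => j.
by rewrite ltnS [in RHS]leq_eqVlt; case: eqP.
Qed.

Section Search.
Variables (f : nat -> nat) (cu : cmd) (inp : nat -> symb) (A h : nat -> nat).
Hypothesis cuP : forall Q m B o, exec Q inp cu
  (Store (rfile 1 B (A m)) (h m) o) (Store (rfile 1 B (A m.+1)) (h m.+1) o).

(** [cu] advances the data and [c] tests a copy of it. Each failure writes a symbol 0, so an endless
    search writes the name of the constant 0; the same loop serves to enumerate c.e. sets and to
    compute in the limit. *)
Definition search_loop (c : cmd) : cmd := While 0 (Seq cu (Seq (copy_reg 2) (Seq c
  (Ite 3 (Seq (clear_reg 3) (Dec 0)) (Seq (Out (Some false) Right) (Inc 1)))))).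

Definition search_store m := Store (rfile 1 m (A m)) (h m) (false_tape m).

Variable c : cmd.
Hypothesis cP : forall r, (forall i, 3 < i -> r i = 0) -> runs c r (upd r 3 (f (r 3))).

Lemma search_check Q m s' :
  exec Q inp (Ite 3 (Seq (clear_reg 3) (Dec 0)) (Seq (Out (Some false) Right) (Inc 1)))
    (Store (upd (rfile 1 m (A m.+1)) 3 (f (A m.+1))) (h m.+1) (false_tape m)) s' ->
  exec Q inp (Seq cu (Seq (copy_reg 2) (Seq c
    (Ite 3 (Seq (clear_reg 3) (Dec 0)) (Seq (Out (Some false) Right) (Inc 1))))))
    (search_store m) s'.
Proof.
move=> H; apply: ExecSeq; first exact: cuP.
apply: ExecSeq; first exact: runs_copy_reg.
apply: ExecSeq; last exact: H.
have -> : upd (rfile 1 m (A m.+1)) 3 (f (A m.+1)) =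
    upd (upd (rfile 1 m (A m.+1)) 3 (A m.+1)) 3 (f (upd (rfile 1 m (A m.+1)) 3 (A m.+1) 3)).
  by rewrite upd_same; apply: funext => i; rewrite /upd; case: eqP.
by apply: cP => -[|[|[|[|[|i]]]]].
Qed.

Lemma search_next Q m : f (A m.+1) = 0 -> Q (false_tape m.+1) ->
  exec Q inp (Seq cu (Seq (copy_reg 2) (Seq c
    (Ite 3 (Seq (clear_reg 3) (Dec 0)) (Seq (Out (Some false) Right) (Inc 1))))))
    (search_store m) (search_store m.+1).
Proof.
move=> f0 Qm; apply: search_check; apply: ExecIteF => //.
apply: ExecSeq; first by apply: ExecOut; rewrite update_false_tape.
have -> : search_store m.+1 = set_reg (Store (upd (rfile 1 m (A m.+1)) 3 (f (A m.+1)))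
    (h m.+1) (false_tape m.+1)) 1 m.+1.
  by congr Store; apply: funext => -[|[|[|[|[|i]]]]]; rewrite /upd ?f0.
by rewrite /= update_false_tape; exact: ExecInc.
Qed.

(** Cell [n] is written in round [n.+1] and then left alone. The advancing head is recorded because
    it excludes halting in [sig1_W]. *)
Lemma search_fails n : (forall m, f (A m.+1) = 0) ->
  eventually_out (fun o => cells o n = Some false /\ n < Defs.head o) inp (search_loop c)
    (search_store 0).
Proof.
move=> f0; apply: (@eventually_out_loop _ _ _ _ search_store n.+1) => //.
- by move=> j; exact: search_next.
- by move=> j nj; apply: search_next => //=; rewrite ltnS (ltnW nj).
- by rewrite /= ltnSn.
Qed.

Lemma search_succeeds Q : (forall m, Q (false_tape m)) -> (exists m, f (A m.+1) <> 0) ->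
  exists m, exec Q inp (search_loop c) (search_store 0)
    (Store (rfile 0 m (A m.+1)) (h m.+1) (false_tape m)).
Proof.
move=> HQ fex; have {}fex : exists m, f (A m.+1) != 0.
  by have [m /eqP fm] := fex; exists m.
case: (ex_minnP fex) => m fm mmin; exists m.
apply: (@exec_while_iter _ _ _ _ search_store m) => [j jm|].
  split=> //; apply: search_next => //; apply/eqP/negPn/negP => /mmin.
  by rewrite leqNgt jm.
apply: (@ExecWhileT _ _ _ _ _ (Store (rfile 0 m (A m.+1)) (h m.+1) (false_tape m))) => //.
  apply: search_check; apply: ExecIteT; first by rewrite /= upd_same; exact/eqP.
  apply: ExecSeq; first exact: runs_clear_reg.
  have -> : Store (rfile 0 m (A m.+1)) (h m.+1) (false_tape m) =
    set_reg (Store (upd (upd (rfile 1 m (A m.+1)) 3 (f (A m.+1))) 3 0)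
      (h m.+1) (false_tape m)) 0 0.
    by congr Store; apply: funext => -[|[|[|[|[|i]]]]].
  exact: ExecDec.
exact: ExecWhileF.
Qed.

End Search.

Theorem sig1_W P : sig1 P -> exists i, forall n, W i n <-> P n.
Proof.
case=> f pf Pf.
(* The search advances its data before testing, so the first test sees [pair_code n 1]; the
   predecessor lets the witness 0 be tried. *)
pose g w := f (pair_code (p1 w) (p2 w).-1).
have pg : prim g by rewrite /g; prim.
have [c Hc] := prim_runs pg 3.
have pu : prim (fun w => pair_code (p1 w) (p2 w).+1) by prim.
have [cu Hcu] := prim_runs pu 2.
have p0 : prim (fun n => pair_code n 0) by prim.
have [c0 Hc0] := prim_runs p0 2.
pose prog := Seq (Seq (read_nat 2) (Seq c0 (Inc 0))) (search_loop cu c).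
exists (pickle (machine_of prog)) => n.
rewrite /W /nth_machine /= pickleK.
have start : exec (fun=> True) (nat_tape n) (Seq (read_nat 2) (Seq c0 (Inc 0)))
    init_store (search_store (fun m => pair_code n m) (fun=> n) 0).
  have [H1 H2] := nat_tape_read n.
  apply: ExecSeq; first exact: exec_read_nat H1 H2.
  apply: ExecSeq; first by apply: Hc0 => -[|[|[|[|i]]]].
  rewrite /search_store /= upd_same.
  have -> : rfile 1 0 (pair_code n 0) = upd (upd (upd (fun=> 0) 2 (0 + n)) 2
    (pair_code (0 + n) 0)) 0 1 by apply: funext => -[|[|[|[|i]]]].
  have -> : false_tape 0 = blank_tape by [].
  exact: ExecInc.
have cuP Q m B o : exec Q (nat_tape n) cu (Store (rfile 1 B (pair_code n m)) n o)
    (Store (rfile 1 B (pair_code n m.+1)) n o).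
  have -> : rfile 1 B (pair_code n m.+1) = upd (rfile 1 B (pair_code n m)) 2
      (pair_code (p1 (rfile 1 B (pair_code n m) 2)) (p2 (rfile 1 B (pair_code n m) 2)).+1).
    by rewrite /= p1K p2K; apply: funext => -[|[|[|[|i]]]].
  by apply: Hcu => -[|[|[|[|i]]]].
have gE m : g (pair_code n m.+1) = f (pair_code n m) by rewrite /g p1K p2K.
split=> [[M [<-]] [t ht]|/Pf[s fs]].
  apply/Pf; apply: contrapT => /forallNP nf.
  have f0 m : g (pair_code n m.+1) = 0 by rewrite gE; apply: contrapT; exact: nf.
  (* Halting freezes the output head at [b], whereas a failing search moves it beyond [b]. *)
  pose b := Defs.head (out (run (machine_of prog) (nat_tape n) t)).
  have := eventually_out_run (eventually_out_seqr start (search_fails cuP Hc b f0)).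
  case=> t0 /(_ (maxn t t0) (leq_maxr _ _)).
  by rewrite (halts_run_const ht (leq_maxl _ _)) ltnn => -[].
have fex : exists m, g (pair_code n m.+1) <> 0 by exists s; rewrite gE.
have [m Hm] := search_succeeds (Q := fun=> True) cuP Hc (fun=> I) fex.
have [t [ht _]] := exec_halts (ExecSeq start Hm).
by exists (machine_of prog) => //; exists t.
Qed.

(** * Limit machines deciding an existential statement about the input *)

Definition block_start (p : nat -> nat) (m : nat) : nat := \sum_(i < m) (p i).+1.

Lemma block_startS p m : block_start p m.+1 = block_start p m + (p m).+1.
Proof. by rewrite /block_start big_ord_recr. Qed.

Lemma block_start_ge p m : m <= block_start p m.
Proof. by elim: m => [//|m IH]; rewrite block_startS; lia. Qed.

Lemma block_start_mono p m n : m <= n -> block_start p m <= block_start p n.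
Proof. by move/subnKC => <-; rewrite /block_start big_split_ord leq_addr. Qed.

Lemma baire_tape1 p m j : j < p m -> baire_tape p (block_start p m + j) = Some true.
Proof.
move=> jp; rewrite /baire_tape; case: existsP => // -[[n /= _]] /eqP.
rewrite -/(block_start p n.+1) => E.
have [nm|nm] := leqP n.+1 m.
  by have := block_start_mono p nm; lia.
by have := block_start_mono p nm; rewrite block_startS; lia.
Qed.

Lemma baire_tape0 p m : baire_tape p (block_start p m + p m) = Some false.
Proof.
rewrite /baire_tape; case: existsP => // -[].
have mp : m < (block_start p m + p m).+1 by have := block_start_ge p m; lia.
by exists (Ordinal mp); rewrite /= -/(block_start p m.+1) block_startS addnS.
Qed.

Lemma block_start_const c m : block_start (fun=> c) m = m * c.+1.
Proof. by rewrite /block_start sum_nat_const card_ord. Qed.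

Lemma baire_tape_const0 n : baire_tape (fun=> 0) n = Some false.
Proof. by have := baire_tape0 (fun=> 0) n; rewrite block_start_const muln1 addn0. Qed.

Lemma baire_tape_const1 n : baire_tape (fun=> 1) n = Some (~~ odd n).
Proof.
have nE := odd_double_half n; rewrite -muln2 in nE.
case: (odd n) nE => nE.
  by have := baire_tape0 (fun=> 1) n./2; rewrite block_start_const addnC nE.
by have := @baire_tape1 (fun=> 1) n./2 0; rewrite block_start_const addn0; rewrite add0n in nE; rewrite nE => ->.
Qed.

(* Codes of reversed prefixes: [<m, <p (m-1), ... <p 0, 0>>>]. *)
Fixpoint prefix_code (p : nat -> nat) (m : nat) : nat :=
  if m is k.+1 then pair_code m (pair_code (p k) (p2 (prefix_code p k))) else 0.

Lemma prefix_code_nth p m i : i <= m ->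
  p1 (iter i p2 (p2 (prefix_code p m.+1))) = p (m - i).
Proof.
elim: i m => [|i IH] m im.
  by rewrite /= p2K p1K subn0.
case: m im => [//|m] im; rewrite iterSr subSS -IH //.
by congr (p1 (iter i p2 _)); rewrite [prefix_code p m.+2]/= !p2K.
Qed.

Definition rewind := While 1 (Seq (Dec 1) (Out (Some false) Left)).

Lemma exec_rewind inp r h o : r 1 = Defs.head o -> exists2 o',
  exec (fun=> True) inp rewind (Store r h o) (Store (upd r 1 0) h o') & Defs.head o' = 0.
Proof.
move E : (r 1) => n; elim: n r o E => [|n IH] r o E ho.
  exists o => //; have -> : upd r 1 0 = r by apply: funext => j; rewrite /upd; case: eqP => [->|].
  exact: ExecWhileF.
have [||o' H ho'] := IH (upd r 1 n) (update_tape o (Some false, Left)).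
- by rewrite upd_same.
- by rewrite /= -ho.
exists o' => //; apply: ExecWhileT; first by rewrite /= E.
  apply: ExecSeq; first exact: ExecDec.
  exact: ExecOut.
rewrite /= E; have <- : upd (upd r 1 n) 1 0 = upd r 1 0 by apply: funext => j; rewrite /upd; case: eqP.
exact: H.
Qed.

Definition write_ones := While 0 (Seq (Out (Some true) Right) (Out (Some false) Right)).

Lemma write_ones_out inp r h o n : r 0 <> 0 -> Defs.head o = 0 ->
  eventually_out (fun o => cells o n = baire_tape (fun=> 1) n /\ n < Defs.head o) inp
    write_ones (Store r h o).
Proof.
move=> r0 ho.
pose tp j := Tape (fun i => if i < j then baire_tape (fun=> 1) i else cells o i) j.
have tpS j : update_tape (tp j) (Some (~~ odd j), Right) = tp j.+1.
  rewrite /tp /update_tape /=; congr Tape; apply: funext => i.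
  by rewrite ltnS [in RHS]leq_eqVlt; case: eqP => [->|//]; rewrite baire_tape_const1.
pose s_ j := Store r h (tp j.*2).
have -> : Store r h o = s_ 0.
  by congr Store; rewrite /tp; case: o ho {tp tpS s_} => c k /= ->.
have body (Q : tape -> Prop) j : Q (tp j.*2.+1) -> Q (tp j.+1.*2) ->
    exec Q inp (Seq (Out (Some true) Right) (Out (Some false) Right)) (s_ j) (s_ j.+1).
  have t1 : update_tape (tp j.*2) (Some true, Right) = tp j.*2.+1.
    by rewrite -tpS odd_double.
  have t2 : update_tape (tp j.*2.+1) (Some false, Right) = tp j.+1.*2.
    by rewrite doubleS -[RHS]tpS /= odd_double.
  move=> Q1 Q2; apply: (@ExecSeq _ _ _ _ _ (Store r h (tp j.*2.+1))).
    by rewrite -t1; apply: ExecOut; rewrite /= t1.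
  by rewrite /s_ -t2; apply: ExecOut; rewrite /= t2.
have tpQ k : n < k -> cells (tp k) n = baire_tape (fun=> 1) n /\ n < Defs.head (tp k).
  by move=> nk; rewrite /= nk.
apply: (@eventually_out_loop _ _ _ _ s_ n.+1) => //.
- by move=> j; exact: body.
- by move=> j nj; apply: body; apply: tpQ; lia.
- by apply: tpQ; lia.
Qed.

Theorem limit_machine f : prim f -> exists M, forall p n, exists t0, forall t, t0 <= t ->
  cells (out (run M (baire_tape p) t)) n =
  baire_tape (fun=> `[< exists k s, f (pair_code (pair_code k (p k)) s) <> 0 >] : nat) n.
Proof.
move=> pf.
(* Prepends the value just read, paired with the old prefix code by [pair_reg], to the reversed
   prefix. *)
pose U w := pair_code (p1 (p1 w)).+1 (pair_code (p2 w) (p2 (p1 w))).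
have pU : prim U by rewrite /U; prim.
have [cU HU] := prim_runs pU 2.
(* Stage [m] is read as a pair of [k] and [s]. As [k <= m], the value [p k] is already in the prefix
   of length [m.+1], at depth [m - k] of the reversed list. *)
pose g a := let m := (p1 a).-1 in
  f (pair_code (pair_code (p1 m) (p1 (iter (m - p1 m) p2 (p2 a)))) (p2 m)).
have pg : prim g by rewrite /g; prim.
have [c Hc] := prim_runs pg 3.
pose cu := Seq (move_reg 2 4) (Seq (read_nat 3) (Seq InRight (Seq (pair_reg 2) cU))).
pose prog := Seq (Inc 0) (Seq (search_loop cu c) (Seq rewind (Seq (Inc 0) write_ones))).
exists (machine_of prog) => p n.
pose A := prefix_code p; pose h := block_start p.
have cuP Q m B o : exec Q (baire_tape p) cu
    (Store (rfile 1 B (A m)) (h m) o) (Store (rfile 1 B (A m.+1)) (h m.+1) o).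
  apply: ExecSeq; first exact: runs_move_reg.
  apply: ExecSeq.
    apply: (@exec_read_nat _ _ _ _ _ _ (p m)); first by move=> j; exact: baire_tape1.
    by rewrite baire_tape0.
  apply: ExecSeq; first exact: ExecInRight.
  rewrite /= -[(_ + _).+1]addnS -block_startS.
  apply: ExecSeq; first exact: runs_pair_reg.
  set r := (X in Store X _ _).
  have -> : rfile 1 B (A m.+1) = upd r 2 (U (r 2)).
    apply: funext => -[|[|[|[|[|i]]]]] //.
    rewrite /r /upd /= /U !p1K !p2K !add0n; congr pair_code.
    by rewrite /A; case: m {r} => //= m; rewrite p1K.
  by apply: HU => -[|[|[|[|[|i]]]]].
have gE m : g (A m.+1) = f (pair_code (pair_code (p1 m) (p (p1 m))) (p2 m)).
  rewrite /g [p1 (A _)]p1K prefix_code_nth ?leq_subr //.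
  by rewrite subKn // p1_le.
have start : exec (fun=> True) (baire_tape p) (Inc 0) init_store (search_store A h 0).
  rewrite /search_store.
  have -> : rfile 1 0 (A 0) = upd (fun=> 0) 0 1 by apply: funext => -[|[|[|[|i]]]].
  have -> : h 0 = 0 by rewrite /h /block_start big_ord0.
  exact: ExecInc.
pose b : nat := `[< exists k s, f (pair_code (pair_code k (p k)) s) <> 0 >].
suff H : eventually_out (fun o => cells o n = baire_tape (fun=> b) n /\ n < Defs.head o)
    (baire_tape p) prog init_store.
  by have [t0 Ht0] := eventually_out_run H; exists t0 => t /Ht0[].
rewrite /b {b}.
apply: eventually_out_seqr start _.
case: asboolP => [[k [s fks]]|nf] /=.
  have fex : exists m, g (A m.+1) <> 0.
    by exists (pair_code k s); rewrite gE p1K p2K.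
  have [m Hm] := search_succeeds (Q := fun=> True) cuP Hc (fun=> I) fex.
  apply: eventually_out_seqr Hm _.
  have [//|o' Ho' ho'] := @exec_rewind (baire_tape p) (rfile 0 m (A m.+1)) (h m.+1) (false_tape m).
  apply: eventually_out_seqr Ho' _.
  apply: eventually_out_seqr; first exact: ExecInc.
  exact: write_ones_out.
(* The search never ends, so the code after it is never reached. *)
apply: eventually_out_seql.
have := search_fails cuP Hc n; rewrite baire_tape_const0; apply=> m.
rewrite gE; apply: contrapT => fm; apply: nf.
by exists (p1 m), (p2 m).
Qed.

(** * Simulation of a fixed machine by a primitive recursive function *)

Lemma prim_iter_fixed f g h : prim f -> prim g -> prim h ->
  prim (fun z => iter (g z) f (h z)).
Proof. by move=> pf pg ph; apply: prim_iterp => //; exact: prim_comp prim_p2. Qed.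

Lemma prim_nth s : prim (nth 0 s).
Proof.
elim: s => [|x s IH].
  by apply: prim_ext (prim_const 0) _ => n; rewrite nth_nil.
have: prim (fun n => if n == 0 then x else nth 0 s n.-1) by prim.
by move/prim_ext; apply=> -[].
Qed.

(** Covers the transition table of a fixed machine, which is a finite function on codes. *)
Lemma prim_finite_support (F : nat -> nat) B : (forall n, B <= n -> F n = 0) -> prim F.
Proof.
move=> FB; apply: prim_ext (prim_nth (mkseq F B)) _ => n.
have [nB|Bn] := ltnP n B; first by rewrite nth_mkseq.
by rewrite nth_default ?size_mkseq ?FB.
Qed.

(* Every number codes the stream [snth l 0, snth l 1, ...], eventually 0 as
   [0 = <0, 0>]. *)
Definition snth (l i : nat) : nat := p1 (iter i p2 l).

Definition lenc : seq nat -> nat := foldr pair_code 0.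

Lemma snth_pair0 a l : snth (pair_code a l) 0 = a.
Proof. exact: p1K. Qed.

Lemma snth_pairS a l i : snth (pair_code a l) i.+1 = snth l i.
Proof. by rewrite /snth iterSr p2K. Qed.

Lemma snth_lenc s i : snth (lenc s) i = nth 0 s i.
Proof.
elim: s i => [|x s IH] [|i] //=; rewrite ?snth_pair0 ?snth_pairS //.
by rewrite /snth /=; elim: i => [//|i]; rewrite iterSr.
Qed.

Lemma prim_snth f g : prim f -> prim g -> prim (fun z => snth (f z) (g z)).
Proof. by move=> pf pg; apply: prim_p1c; apply: prim_iter_fixed => //; exact: prim_p2. Qed.

Lemma prim_lenc (T : Type) (F : T -> nat -> nat) (s : seq T) :
  (forall x, prim (F x)) -> prim (fun z => lenc [seq F x z | x <- s]).
Proof. by move=> pF; elim: s => [|x s IH] /=; prim; exact: pF. Qed.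

Definition scode (a : symb) : nat :=
  match a with None => 0 | Some false => 1 | Some true => 2 end.

Lemma scode_inj : injective scode.
Proof. by do 2![case=> [[]|]]. Qed.

Definition mcode (m : move) : nat := match m with Stay => 0 | Left => 1 | Right => 2 end.

Definition move_headc (m h : nat) : nat := if m == 2 then h.+1 else if m == 1 then h.-1 else h.

Lemma move_headcE m h : move_headc (mcode m) h = move_head m h.
Proof. by case: m. Qed.

(* A tape is coded as [<h, <L, R>>]: the stream [R] starts at the head position
   [h], and [L] lists the cells to the left of the head from right to left. *)
Definition tape_codes (T : nat) (t : tape) : Prop :=
  [/\ p1 T = Defs.head t,
      forall j, snth (p2 (p2 T)) j = scode (cells t (Defs.head t + j)) &
      forall j, j < Defs.head t ->
        snth (p1 (p2 T)) j = scode (cells t (Defs.head t - j.+1))].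

Definition scannedc (T : nat) : nat := p1 (p2 (p2 T)).

Definition update_tapec (T a m : nat) : nat :=
  let h := p1 T in let L := p1 (p2 T) in let R := p2 (p2 (p2 T)) in
  if m == 2 then pair_code h.+1 (pair_code (pair_code a L) R)
  else if (m == 1) && ~~ (h == 0) then
    pair_code h.-1 (pair_code (p2 L) (pair_code (p1 L) (pair_code a R)))
  else pair_code h (pair_code L (pair_code a R)).

Definition cellc (T j : nat) : nat :=
  if p1 T <= j then snth (p2 (p2 T)) (j - p1 T) else snth (p1 (p2 T)) (p1 T - j.+1).

Lemma scannedcE T t : tape_codes T t -> scannedc T = scode (scanned t).
Proof. by case=> _ /(_ 0); rewrite addn0. Qed.

Lemma cellcE T t j : tape_codes T t -> cellc T j = scode (cells t j).
Proof.
case=> hT RT LT; rewrite /cellc hT; case: leqP => hj; first by rewrite RT subnKC.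
by rewrite LT; last lia; congr (scode (cells t _)); lia.
Qed.

Lemma snth_p2 l j : snth (p2 l) j = snth l j.+1.
Proof. by rewrite -{2}[l]pair_codeK snth_pairS. Qed.

Lemma update_tapecE T t a m : tape_codes T t ->
  tape_codes (update_tapec T (scode a) (mcode m)) (update_tape t (a, m)).
Proof.
case=> hT RT LT; rewrite /update_tapec hT; case: m => /=.
- case: eqP => [h0|/eqP h0] /=; split; rewrite /= ?p1K ?p2K ?p1K ?h0 //.
  + case=> [|j]; first by rewrite snth_pair0.
    by rewrite snth_pairS snth_p2 RT h0.
  + case=> [|[|j]].
    * rewrite snth_pair0 addn0 ifN; last lia.
      by have := LT 0; rewrite subn1 lt0n => /(_ h0) <-.
    * by rewrite snth_pairS snth_pair0 ifT //; lia.
    * rewrite !snth_pairS snth_p2 RT ifN; last lia.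
      by congr (scode (cells t _)); lia.
  + move=> j jh; rewrite snth_p2 LT; last lia.
    by rewrite ifN; [congr (scode (cells t _)); lia|lia].
- split; rewrite /= ?p1K ?p2K ?p1K //.
  + case=> [|j]; first by rewrite snth_pair0 addn0 eqxx.
    by rewrite snth_pairS snth_p2 RT ifN //; lia.
  + by move=> j jh; rewrite LT // ifN //; lia.
- split; rewrite /= ?p1K ?p2K ?p1K //.
  + by move=> j; rewrite snth_p2 RT ifN ?addnS //; lia.
  + case=> [|j] jh; first by rewrite snth_pair0 subn1 eqxx.
    by rewrite snth_pairS LT // ifN ?subSS //; lia.
Qed.

Lemma prim_scannedc f : prim f -> prim (fun z => scannedc (f z)).
Proof. by move=> pf; rewrite /scannedc; prim. Qed.

Lemma prim_update_tapec f g h : prim f -> prim g -> prim h ->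
  prim (fun z => update_tapec (f z) (g z) (h z)).
Proof. by move=> pf pg ph; rewrite /update_tapec; prim. Qed.

Lemma prim_cellc f g : prim f -> prim g -> prim (fun z => cellc (f z) (g z)).
Proof.
by move=> pf pg; rewrite /cellc; apply: prim_if; prim; apply: prim_snth; prim.
Qed.

Section Simulation.
Variable M : turing_machine.

Notation k := (work_tapes M).
Notation q := (last_state M).
Notation key := ('I_q.+1 * symb * k.-tuple symb * symb)%type.

Definition key_code (x : key) : nat := let: (s, a, ws, o) := x in
  pair_code s (pair_code (scode a) (pair_code (scode o) (lenc (map scode ws)))).

Lemma lenc_inj s1 s2 : size s1 = size s2 -> lenc s1 = lenc s2 -> s1 = s2.
Proof.
by move=> ss E; apply: (@eq_from_nth _ 0) => // i _; rewrite -!snth_lenc E.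
Qed.

Lemma pair_code_inj a b c d : pair_code a b = pair_code c d -> a = c /\ b = d.
Proof.
by move=> E; have := congr1 p1 E; have := congr1 p2 E; rewrite !p1K !p2K.
Qed.

Lemma key_code_inj : injective key_code.
Proof.
move=> [[[s a] ws] o] [[[s' a'] ws'] o'] /pair_code_inj[/val_inj ->].
move=> /pair_code_inj[/scode_inj ->] /pair_code_inj[/scode_inj ->] E.
congr (_, _, _, _); apply: val_inj; apply: (inj_map scode_inj).
by apply: lenc_inj => //; rewrite !size_map !size_tuple.
Qed.

Definition action_code
    (r : option ('I_q.+1 * move * k.-tuple (symb * move) * (symb * move))) : nat :=
  if r is Some (s, m, ws, o) then
    (pair_code s (pair_code (mcode m) (pair_code (pair_code (scode o.1) (mcode o.2))
      (lenc [seq pair_code (scode x.1) (mcode x.2) | x <- ws])))).+1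
  else 0.

Definition tablec (n : nat) : nat :=
  if [pick x | key_code x == n] is Some x then action_code (tagged M x) else 0.

Lemma tablecE x : tablec (key_code x) = action_code (tagged M x).
Proof.
rewrite /tablec; case: pickP => [y /eqP/key_code_inj -> //|/(_ x)].
by rewrite eqxx.
Qed.

Lemma prim_tablec : prim tablec.
Proof.
apply: (@prim_finite_support _ (\max_x key_code x).+1) => n nB.
rewrite /tablec; case: pickP => // x /eqP E.
by move: nB; rewrite -E ltnNge leq_bigmax.
Qed.

(* Configurations are coded as
   [<state, <input head, <output tape, list of work tapes>>>]. *)
Definition config_codes (C : nat) (c : config M) : Prop :=
  [/\ p1 C = state c, p1 (p2 C) = in_head c, tape_codes (p1 (p2 (p2 C))) (out c) &
      forall l : 'I_k, tape_codes (snth (p2 (p2 (p2 C))) l) (work c l)].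

Definition key_of (C a : nat) : nat :=
  pair_code (p1 C) (pair_code a (pair_code (scannedc (p1 (p2 (p2 C))))
    (lenc [seq scannedc (snth (p2 (p2 (p2 C))) (val l)) | l <- enum 'I_k]))).

Lemma key_ofE C c a : config_codes C c ->
  key_of C (scode a) =
  key_code (state c, a, [tuple scanned (work c l) | l < k], scanned (out c)).
Proof.
case=> sC iC oC wC; rewrite /key_of /key_code sC (scannedcE oC).
congr (pair_code _ (pair_code _ (pair_code _ (lenc _)))).
rewrite /= -map_comp; apply: eq_map => l; exact: scannedcE.
Qed.

Definition nextc (C a : nat) : nat :=
  let A := tablec (key_of C a) in let B := A.-1 in
  if A == 0 then C else
  pair_code (p1 B) (pair_code (move_headc (p1 (p2 B)) (p1 (p2 C)))
    (pair_code (update_tapec (p1 (p2 (p2 C))) (p1 (p1 (p2 (p2 B)))) (p2 (p1 (p2 (p2 B)))))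
      (lenc [seq update_tapec (snth (p2 (p2 (p2 C))) (val l))
                   (p1 (snth (p2 (p2 (p2 B))) (val l)))
                   (p2 (snth (p2 (p2 (p2 B))) (val l))) | l <- enum 'I_k]))).

Lemma haltedcE C c input : config_codes C c ->
  tablec (key_of C (scode (input (in_head c)))) = 0 <-> step input c = None.
Proof.
move=> Cc; rewrite (key_ofE _ Cc) tablecE /step.
by case: (tagged M _) => [[[[s m] ws] o]|].
Qed.

Lemma nextcE C c input : config_codes C c ->
  config_codes (nextc C (scode (input (in_head c)))) (odflt c (step input c)).
Proof.
move=> Cc; rewrite /nextc (key_ofE _ Cc) tablecE /step.
case: (tagged M _) => [[[[s m] ws] o]|//].
case: Cc => sC iC oC wC.
rewrite /action_code /= /config_codes !(p1K, p2K) iC move_headcE; split=> //=.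
  by case: o => a m'; exact: update_tapecE.
move=> l; rewrite !snth_lenc (nth_map l) ?size_enum_ord // nth_ord_enum.
rewrite !snth_lenc (nth_map (tnth ws l)) ?size_tuple // -tnth_nth.
by case: (tnth ws l) => a m' /=; rewrite !(p1K, p2K); exact: update_tapecE.
Qed.

(** As [0 = <0, 0>], every component of 0 is 0: initial state, heads at the left end, blank
    tapes. *)
Lemma config_codes_init : config_codes 0 (init_config M).
Proof.
have s0 i : snth 0 i = 0 by rewrite (snth_lenc [::]) nth_nil.
have t0 : tape_codes 0 blank_tape by split=> // j; exact: s0.
by split=> //= l; rewrite s0.
Qed.

(** A family of inputs, so that one simulation serves both numbers and coded streams [snth l]. *)
Variable input : nat -> nat -> symb.
Hypothesis prim_input : prim (fun w => scode (input (p1 w) (p2 w))).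

Definition runc (z t : nat) : nat :=
  iter t (fun C => nextc C (scode (input z (p1 (p2 C))))) 0.

Lemma runcE z t : config_codes (runc z t) (run M (input z) t).
Proof.
elim: t => [|t IH]; first exact: config_codes_init.
rewrite /runc /run !iterS -/(runc z t) -/(run M (input z) t).
by have [_ -> _ _] := IH; exact: nextcE.
Qed.

Lemma prim_key_of f g : prim f -> prim g -> prim (fun z => key_of (f z) (g z)).
Proof.
move=> pf pg; rewrite /key_of; prim; first by apply: prim_scannedc; prim.
apply: (@prim_lenc _ (fun l z => scannedc (snth (p2 (p2 (p2 (f z)))) (val l)))) => l.
by apply: prim_scannedc; apply: prim_snth; prim.
Qed.

Lemma prim_move_headc f g : prim f -> prim g -> prim (fun z => move_headc (f z) (g z)).
Proof. by move=> pf pg; rewrite /move_headc; prim. Qed.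

Lemma prim_nextc f g : prim f -> prim g -> prim (fun z => nextc (f z) (g z)).
Proof.
move=> pf pg; rewrite /nextc.
have pA : prim (fun z => tablec (key_of (f z) (g z))).
  by apply: (prim_comp prim_tablec); exact: prim_key_of.
set F := fun z => tablec _ in pA.
have pB : prim (fun z => (F z).-1) by prim.
apply: prim_if; prim.
- by apply: prim_move_headc; prim.
- by apply: prim_update_tapec; prim.
apply: (@prim_lenc _ (fun l z => update_tapec (snth (p2 (p2 (p2 (f z)))) (val l))
  (p1 (snth (p2 (p2 (p2 (F z).-1))) (val l))) (p2 (snth (p2 (p2 (p2 (F z).-1))) (val l))))) => l.
by apply: prim_update_tapec; prim; apply: prim_snth; prim.
Qed.

Lemma prim_runc f g : prim f -> prim g -> prim (fun z => runc (f z) (g z)).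
Proof.
move=> pf pg; apply: (@prim_app2 runc) => //; rewrite /runc.
pose G w C := nextc C (scode (input (p1 w) (p1 (p2 C)))).
apply: (@prim_iterp G); prim.
rewrite /G; apply: prim_nextc; prim.
by apply: (@prim_app2 (fun a b => scode (input a b))); prim.
Qed.

Lemma prim_out f g h : prim f -> prim g -> prim h ->
  prim (fun z => scode (cells (out (run M (input (f z)) (g z))) (h z))).
Proof.
move=> pf pg ph.
have: prim (fun z => cellc (p1 (p2 (p2 (runc (f z) (g z))))) (h z)).
  by apply: prim_cellc; prim; exact: prim_runc.
move/prim_ext; apply=> z; apply: cellcE.
by have [] := runcE (f z) (g z).
Qed.

Lemma prim_halts : exists2 f, prim f &
  forall z t, f (pair_code z t) <> 0 <-> halts_at M (input z) t.
Proof.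
pose F z t := let C := runc z t in
  nat_of_bool (tablec (key_of C (scode (input z (p1 (p2 C))))) == 0).
exists (fun w => F (p1 w) (p2 w)) => [|z t].
  rewrite /F; apply: prim_eq0; apply: (prim_comp prim_tablec).
  have ? : prim (fun z => runc (p1 z) (p2 z)) by apply: prim_runc; prim.
  apply: prim_key_of; prim.
  by apply: (@prim_app2 (fun a b => scode (input a b))); prim.
rewrite p1K p2K /F /halts_at -(haltedcE _ (runcE z t)).
have [_ <- _ _] := runcE z t.
by split=> [|->] //; case: eqP.
Qed.

End Simulation.

(** * C.e. predicates and codes of rationals *)

Lemma sig1_iff P Q : (forall n, P n <-> Q n) -> sig1 P -> sig1 Q.
Proof. by move=> PQ [f pf fP]; exists f => // n; rewrite -PQ. Qed.

Lemma sig1_prim (b : nat -> bool) : prim b -> sig1 b.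
Proof.
move=> pb; exists (fun w => b (p1 w) : nat) => [|n]; first exact: prim_comp pb prim_p1.
split=> [bn|[s]]; first by exists 0; rewrite p1K bn.
by rewrite p1K; case: (b n).
Qed.

Lemma sig1_comp P f : sig1 P -> prim f -> sig1 (fun n => P (f n)).
Proof.
move=> [g pg gP] pf; exists (fun w => g (pair_code (f (p1 w)) (p2 w))) => [|n].
  by prim.
by rewrite gP; split=> -[s gs]; exists s; move: gs; rewrite p1K p2K.
Qed.

Lemma sig1_and P Q : sig1 P -> sig1 Q -> sig1 (fun n => P n /\ Q n).
Proof.
move=> [f pf fP] [g pg gQ].
exists (fun w => f (pair_code (p1 w) (p1 (p2 w))) * g (pair_code (p1 w) (p2 (p2 w)))).
  by prim.
move=> n; rewrite fP gQ; split=> [[[s fs] [t gt]]|[s]].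
  by exists (pair_code s t); rewrite !(p1K, p2K); lia.
rewrite p1K p2K => H; split; [exists (p1 s)|exists (p2 s)] => E; apply: H.
  by rewrite E.
by rewrite E muln0.
Qed.

Lemma sig1_ex (P : nat -> nat -> Prop) : sig1 (fun w => P (p1 w) (p2 w)) ->
  sig1 (fun n => exists m, P n m).
Proof.
move=> [f pf fP].
exists (fun w => f (pair_code (pair_code (p1 w) (p1 (p2 w))) (p2 (p2 w)))); first by prim.
move=> n; split=> [[m]|[s]].
  have := fP (pair_code n m); rewrite p1K p2K => -> [s fs].
  by exists (pair_code m s); rewrite !(p1K, p2K).
rewrite p1K p2K => H; exists (p1 s).
have : exists t, f (pair_code (pair_code n (p1 s)) t) <> 0 by exists (p2 s).
by rewrite -fP p1K p2K.
Qed.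

(** Witnesses for all [k < h n] are packed into one list; the product of the tests along it is
    nonzero iff all of them succeed. *)
Lemma sig1_all (P : nat -> nat -> Prop) h : prim h -> sig1 (fun w => P (p1 w) (p2 w)) ->
  sig1 (fun n => forall k, k < h n -> P n k).
Proof.
move=> ph [f pf fP].
pose step z C := pair_code (p1 C).+1
  (p2 C * f (pair_code (pair_code (p1 z) (p1 C)) (snth (p2 z) (p1 C)))).
pose g z := p2 (iter (h (p1 z)) (step z) (pair_code 0 1)).
have pg : prim g.
  rewrite /g; apply: prim_p2c; apply: prim_iterp; rewrite /step; prim.
  by apply: prim_snth; prim.
have gE n l : g (pair_code n l) <> 0 <->
    forall k, k < h n -> f (pair_code (pair_code n k) (snth l k)) <> 0.
  have stepE C : step (pair_code n l) C = pair_code (p1 C).+1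
      (p2 C * f (pair_code (pair_code n (p1 C)) (snth l (p1 C)))).
    by rewrite /step p1K p2K.
  rewrite /g p1K.
  suff H : forall N, p1 (iter N (step (pair_code n l)) (pair_code 0 1)) = N /\
    (p2 (iter N (step (pair_code n l)) (pair_code 0 1)) <> 0 <->
      forall k, k < N -> f (pair_code (pair_code n k) (snth l k)) <> 0) by case: (H (h n)).
  elim=> [|N [IH1 IH2]]; first by rewrite /= p1K p2K.
  rewrite iterS stepE p1K p2K IH1; split=> //.
  split=> [H k|H].
    rewrite ltnS leq_eqVlt => /orP[/eqP ->|kN].
      by move=> E; apply: H; rewrite E muln0.
    by apply: (iffLR IH2) => // E; apply: H; rewrite E.
  have: p2 (iter N (step (pair_code n l)) (pair_code 0 1)) <> 0.
    by apply/IH2 => k kN; apply: H; exact: ltnW.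
  by have := H N (ltnSn N); lia.
exists g => // n; split=> [H|[l /gE H] k kn].
  have {}H k : exists s, k < h n -> f (pair_code (pair_code n k) s) <> 0.
    have [/H|nk] := boolP (k < h n); last by exists 0.
    have := fP (pair_code n k); rewrite p1K p2K => -> [s fs].
    by exists s.
  have [s sP] := choice H.
  exists (lenc (mkseq s (h n))); apply/gE => k kn.
  by rewrite snth_lenc nth_mkseq //; exact: sP.
have := fP (pair_code n k); rewrite p1K p2K => ->.
by exists (snth l k); exact: H.
Qed.

Lemma prim_nat_tape : prim (fun w => scode (nat_tape (p1 w) (p2 w))).
Proof.
have: prim (fun w => if p2 w < p1 w then 2 else 0) by prim.
by move/prim_ext; apply=> w; rewrite /nat_tape; case: ifP.
Qed.

Lemma sig1_W_index i : sig1 (W i).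
Proof.
rewrite /W; case E : (nth_machine i) => [M|]; last first.
  apply: sig1_iff (@sig1_prim xpred0 _) => [n|]; last exact: prim_const.
  by split=> // -[].
have [f pf fM] := prim_halts M prim_nat_tape.
exists f => // n; split=> [[_ [<-] [t /fM ft]]|[t /fM ft]]; first by exists t.
by exists M => //; exists t.
Qed.

(** A computable [g], such as the one approximating distances, need not be primitive recursive; it
    enters c.e. conditions through its graph. *)
Lemma sig1_graph g : computable_nat g -> sig1 (fun w => p2 w = g (p1 w)).
Proof.
case=> M HM; have [f pf fM] := prim_halts M prim_nat_tape.
pose cell n t j := scode (cells (out (run M (nat_tape n) t)) j).
(* On the tape [1^(g n)] one has [v = g n] iff cell [v] is not 1 and, unless [v = 0], cell [v.-1] is
   1. The symbol 1 has code 2. *)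
pose test u := (f (pair_code (p1 (p1 u)) (p2 u)) != 0) &&
  ((cell (p1 (p1 u)) (p2 u) (p2 (p1 u)) != 2) &&
   ~~ ((p2 (p1 u) != 0) && (cell (p1 (p1 u)) (p2 u) (p2 (p1 u)).-1 != 2))).
have pcell a b c : prim a -> prim b -> prim c -> prim (fun z => cell (a z) (b z) (c z)).
  exact: (prim_out M prim_nat_tape).
have ptest : prim test.
  apply: prim_andb; first by prim.
  apply: prim_andb; first by apply: prim_neg; prim; apply: pcell; prim.
  by apply: prim_neg; prim; apply: pcell; prim.
apply: sig1_iff (sig1_ex (P := fun w t => test (pair_code w t)) _); last first.
  by apply: sig1_iff (sig1_prim ptest) => u; rewrite pair_codeK.
move=> w; rewrite -{1}[w]pair_codeK; move: (p1 w) (p2 w) => {w} n v.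
have [t ht ot] := HM n.
have scode2 a : scode a != 2 = (a != Some true) by case: a => [[]|].
have cellE u : halts_at M (nat_tape n) u ->
    forall j, (cell n u j != 2) = (g n <= j).
  move=> hu j; have -> : cell n u j = cell n t j.
    rewrite /cell; have [tu|/ltnW ut] := leqP t u.
      by rewrite (halts_run_const ht tu).
    by rewrite (halts_run_const hu ut).
  by rewrite scode2 ot /nat_tape; case: ltnP.
split=> [[u]|->].
  rewrite /test !(p1K, p2K) => /andP[/eqP /fM hu /andP[]].
  rewrite !(cellE _ hu) => gv; rewrite negb_and negbK -ltnNge => /orP[/eqP|]; lia.
exists t; rewrite /test !(p1K, p2K) !(cellE _ ht) leqnn /=.
apply/andP; split; first by apply/eqP/fM.
by case: (g n) => [|m] //=; rewrite -ltnNge.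
Qed.

(** Advances by one cell on the tape of [snth l]: a 1 is taken from the first block, or the block is
    dropped at its closing 0. Cell [i] is 0 iff the first entry left after [i] steps is 0. *)
Definition eat (l : nat) : nat :=
  if p1 l == 0 then p2 l else pair_code (p1 l).-1 (p2 l).

Lemma iter_eat l m j : j <= snth l m ->
  iter (block_start (snth l) m + j) eat l = pair_code (snth l m - j) (iter m.+1 p2 l).
Proof.
elim: m j => [|m IHm]; last first.
  elim=> [_|j IHj jl]; last first.
    rewrite addnS iterS IHj 1?ltnW // /eat p1K p2K ifN; last by lia.
    by rewrite subnS.
  rewrite addn0 block_startS addnS iterS IHm // subnn /eat p1K eqxx p2K subn0.
  by rewrite /snth -[iter m.+1 p2 l in LHS]pair_codeK.
elim=> [_|j IHj jl].
  by rewrite /block_start big_ord0 /= subn0 /snth /= pair_codeK.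
rewrite addnS iterS IHj 1?ltnW // /eat p1K p2K ifN; last by lia.
by rewrite subnS.
Qed.

Lemma block_decomp p i : exists m j, j <= p m /\ i = block_start p m + j.
Proof.
elim: i => [|i [m [j [jm ->]]]].
  by exists 0, 0; rewrite /block_start big_ord0.
move: jm; rewrite leq_eqVlt => /orP[/eqP ->|jm].
  by exists m.+1, 0; rewrite block_startS addn0 addnS.
by exists m, j.+1; rewrite addnS.
Qed.

Lemma prim_baire_tape : prim (fun w => scode (baire_tape (snth (p1 w)) (p2 w))).
Proof.
have: prim (fun w => if p1 (iter (p2 w) eat (p1 w)) == 0 then 1 else 2).
  prim.
  by rewrite /eat; prim.
move/prim_ext; apply=> w; have [m [j [jm ->]]] := block_decomp (snth (p1 w)) (p2 w).
rewrite iter_eat // p1K; case: eqP => jm'.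
  have -> : j = snth (p1 w) m by lia.
  by rewrite baire_tape0.
by rewrite baire_tape1 //; lia.
Qed.

Section RationalCodes.
Variable R : realType.
Local Open Scope ring_scope.

Definition rnum (r : nat) : R := (p1 r)%:R - (p1 (p2 r))%:R.
Definition rden (r : nat) : R := (p2 (p2 r)).+1%:R.

Lemma rat_of_codeE r : rat_of_code R r = rnum r / rden r.
Proof. by rewrite /rat_of_code of_natE of_natE. Qed.

Lemma rden_gt0 r : 0 < rden r.
Proof. exact: ltr0Sn. Qed.

Definition rat_add (a b : nat) : nat :=
  let da := (p2 (p2 a)).+1 in let db := (p2 (p2 b)).+1 in
  pair_code (p1 a * db + p1 b * da)
    (pair_code (p1 (p2 a) * db + p1 (p2 b) * da) (da * db).-1).

Definition rat_opp (a : nat) : nat :=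
  pair_code (p1 (p2 a)) (pair_code (p1 a) (p2 (p2 a))).

Definition rat_abs (a : nat) : nat :=
  pair_code (p1 a - p1 (p2 a) + (p1 (p2 a) - p1 a)) (pair_code 0 (p2 (p2 a))).

Definition rat_pow (k : nat) : nat := pair_code 1 (pair_code 0 (2 ^ k).-1).

Definition rat_lt (a b : nat) : bool :=
  (p1 a * (p2 (p2 b)).+1 + p1 (p2 b) * (p2 (p2 a)).+1 <
   p1 b * (p2 (p2 a)).+1 + p1 (p2 a) * (p2 (p2 b)).+1)%N.

Lemma rat_addE a b : rat_of_code R (rat_add a b) = rat_of_code R a + rat_of_code R b.
Proof.
rewrite !rat_of_codeE /rnum /rden /rat_add !(p1K, p2K) prednK ?muln_gt0 //.
have a0 : ((p2 (p2 a)).+1%:R : R) != 0 by [].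
have b0 : ((p2 (p2 b)).+1%:R : R) != 0 by [].
by rewrite addf_div // !natrD !natrM; congr (_ / _); ring.
Qed.

Lemma rat_oppE a : rat_of_code R (rat_opp a) = - rat_of_code R a.
Proof. by rewrite !rat_of_codeE /rnum /rden /rat_opp !(p1K, p2K) -mulNr opprB. Qed.

Lemma rat_absE a : rat_of_code R (rat_abs a) = `|rat_of_code R a|.
Proof.
rewrite !rat_of_codeE /rnum /rden /rat_abs !(p1K, p2K) normrM subr0.
rewrite [`|_^-1|]ger0_norm ?invr_ge0 ?ler0n //; congr (_ / _).
have [ab|/ltnW ab] := leqP (p1 a) (p1 (p2 a)).
  rewrite (eqP ab) add0n ler0_norm ?subr_le0 ?ler_nat //.
  by rewrite natrB // opprB.
by rewrite (eqP ab) addn0 ger0_norm ?subr_ge0 ?ler_nat // natrB.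
Qed.

Lemma rat_powE k : rat_of_code R (rat_pow k) = 2 ^- k.
Proof.
rewrite !rat_of_codeE /rnum /rden /rat_pow !(p1K, p2K) prednK ?expn_gt0 //.
by rewrite subr0 mul1r natrX.
Qed.

Lemma rat_ltE a b : rat_lt a b = (rat_of_code R a < rat_of_code R b).
Proof.
rewrite !rat_of_codeE ltr_pdivrMr ?rden_gt0 // mulrAC ltr_pdivlMr ?rden_gt0 //.
rewrite /rat_lt -(ltr_nat R) !natrD !natrM /rnum /rden !mulrBl.
by rewrite ltrBlDr addrAC ltrBrDr.
Qed.

End RationalCodes.

Lemma prim_rat_add f g : prim f -> prim g -> prim (fun z => rat_add (f z) (g z)).
Proof. by move=> pf pg; rewrite /rat_add; prim. Qed.

Lemma prim_rat_opp f : prim f -> prim (fun z => rat_opp (f z)).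
Proof. by move=> pf; rewrite /rat_opp; prim. Qed.

Lemma prim_rat_abs f : prim f -> prim (fun z => rat_abs (f z)).
Proof. by move=> pf; rewrite /rat_abs; prim. Qed.

Lemma prim_rat_pow f : prim f -> prim (fun z => rat_pow (f z)).
Proof. by move=> pf; rewrite /rat_pow; prim. Qed.

Lemma prim_rat_lt f g : prim f -> prim g -> prim (fun z => rat_lt (f z) (g z) : nat).
Proof. by move=> pf pg; rewrite /rat_lt; prim. Qed.

(** * Names of points *)

Local Open Scope classical_set_scope.
Local Open Scope ring_scope.

Section Metric.
Variable R : realType.

Lemma nbhs_mdistE (T : metricType R) (x : T) (A : set T) :
  nbhs x A <-> exists2 e, 0 < e & forall y, mdist x y < e -> A y.
Proof. by rewrite -metricType_numDomainType.filter_from_mdist_nbhs; split. Qed.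

Lemma continuous_subspace_mdistP (S T : metricType R) (D : set S) (f : S -> T) x : D x ->
  {for x, continuous (f : subspace D -> T)} <->
  forall e, 0 < e -> exists2 d, 0 < d &
    forall y, D y -> mdist x y < d -> mdist (f x) (f y) < e.
Proof.
move=> Dx; rewrite /prop_for /continuous_at; case: _ / (@nbhs_subspaceP _ D x) => // _.
split=> [fx e e0|H A].
  have : nbhs (f x) [set z | mdist (f x) z < e] by apply/nbhs_mdistE; exists e.
  move/fx; rewrite /= /within /= => /nbhs_mdistE[d d0 dP].
  by exists d => // y Dy /dP; apply.
move=> /nbhs_mdistE[e e0 eA]; have [d d0 dP] := H e e0.
by apply/nbhs_mdistE; exists d => // y xy Dy; apply: eA; exact: dP.
Qed.

(** In a product of discrete spaces, continuity at a point means that every coordinate is locally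
    constant there. *)
Lemma one_genericP (X : computable_metric_space R) (x : X) : one_generic x <->
  forall i, exists2 d, 0 < d &
    forall y : X, mdist x y < d -> (ce_open X i y <-> ce_open X i x).
Proof.
have jE i (y : X) : turing_jump y i = turing_jump x i <-> (ce_open X i y <-> ce_open X i x).
  rewrite /turing_jump; case: ifPn; rewrite ?(inE, notin_setE) => yU;
    case: ifPn; rewrite ?(inE, notin_setE) => xU; split=> //.
  - by case=> /(_ yU).
  - by case=> _ /(_ xU).
rewrite /one_generic /prop_for /continuous_at; split=> [H i|H].
  have pr := @proj_continuous nat (fun=> nat) i (turing_jump x).
  have : nbhs (turing_jump x i) [set turing_jump x i] by rewrite nbhs_principalE.
  move/(cvg_comp _ _ H pr) => /= /nbhs_mdistE[d d0 dP].
  by exists d => // y /dP /jE.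
apply/pointwise_cvgP => i A /=; rewrite {1}nbhs_principalE => Ai.
have [d d0 dP] := H i; apply/nbhs_mdistE; exists d => // y /dP /jE E.
by rewrite /preimage /= E; apply: Ai.
Qed.

Lemma expV2_gt0 k : 0 < 2 ^- k :> R.
Proof. by rewrite invr_gt0 exprn_gt0. Qed.

Lemma expV2_half k : 2 ^- k.+1 = 2 ^- k / 2 :> R.
Proof. by rewrite exprSr invfM. Qed.

Lemma expV2_le k n : (k <= n)%N -> 2 ^- n <= 2 ^- k :> R.
Proof. by move=> kn; rewrite lef_pV2 ?posrE ?exprn_gt0 // ler_eXn2l // ltr1n. Qed.

Lemma expV2_lt (e : R) : 0 < e -> exists k, 2 ^- k < e.
Proof.
move=> e0; exists (Num.bound e^-1).
rewrite -[ltRHS]invrK ltf_pV2 ?posrE ?exprn_gt0 ?invr_gt0 //.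
apply: lt_trans (archi_boundP _) _; first by rewrite invr_ge0 ltW.
by have := ltn_expl (Num.bound e^-1) (ltnSn 1); rewrite -(ltr_nat R) natrX.
Qed.

Section Names.
Variable X : computable_metric_space R.
Implicit Types (p : nat -> nat) (x y : X).

Notation alpha := (cms_seq X).

Lemma cauchy_name_dist p y k : cauchy_name p y -> mdist (alpha (p k)) y <= 2 ^- k.
Proof.
case=> pC pl; apply/ler_addgt0Pr => e e0.
have [N _ HN] := metricType_numDomainType.cvgr_dist_lt pl e0.
pose n := maxn N k.
have := HN n (leq_maxl _ _) => /=; rewrite metric_sym => ny.
have := pC k n (leq_maxr _ _); rewrite metric_sym => kn.
apply: le_trans (metric_triangle _ (alpha (p n)) _) _.
by apply: lerD; exact: ltW.
Qed.

Lemma seq_near (y : X) (e : R) : 0 < e -> exists c, mdist y (alpha c) < e.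
Proof.
move=> e0; have yO : nbhs y [set z | mdist y z < e] by apply/nbhs_mdistE; exists e.
have [|z [/interior_subset zO [c _ cz]]] := @cms_dense R X _ _ (open_interior [set z | mdist y z < e]).
  by exists y.
by exists c; rewrite cz.
Qed.

(* Strengthening 2^-k to 2^-(k+1) makes every prefix of such a name of [y] a
   prefix of a name of every point close to [y]. *)
Definition tight_prefix p t y := forall k, (k <= t)%N -> mdist y (alpha (p k)) < 2 ^- k.+1.

Definition tight_name p y := forall k, mdist y (alpha (p k)) < 2 ^- k.+1.

Lemma tight_name_cauchy p y : tight_name p y -> cauchy_name p y.
Proof.
move=> py; split=> [k n kn|].
  apply: le_lt_trans (metric_triangle _ y _) _; rewrite metric_sym.
  rewrite [ltRHS](splitr (2 ^- k)) -expV2_half; apply: ltrD; last exact: py.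
  by apply: lt_le_trans (py n) _; exact: expV2_le.
apply/metricType_numDomainType.cvgrPdist_lt => e e0.
have [N Ne] := expV2_lt e0; exists N => // n /= Nn.
apply: lt_trans (py n) _; apply: le_lt_trans Ne; apply: expV2_le; exact: leqW.
Qed.

End Names.
End Metric.

(** * Continuity implies genericity *)

Lemma sig1_graph_comp g a b : computable_nat g -> prim a -> prim b ->
  sig1 (fun n => a n = g (b n)).
Proof.
move=> cg pa pb; have pab : prim (fun n => pair_code (b n) (a n)) by prim.
by apply: sig1_iff (sig1_comp (sig1_graph cg) pab) => n; rewrite p1K p2K.
Qed.

Section Reals.
Variable R : realType.

Lemma rat_of_code_surj (q : rat) : exists r, rat_of_code R r = ratr q.
Proof.
have [d dE] : exists d : nat, denq q = d.+1%:Z.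
  by have := denq_gt0 q; case: (denq q) => [[|d]|] // _; exists d.
suff [r rE] : exists r, rat_of_code R r = (numq q)%:~R / d.+1%:R.
  by exists r; rewrite rE /ratr dE.
case: (numq q) => n.
  exists (pair_code n (pair_code 0 d)).
  by rewrite rat_of_codeE /rnum /rden !(p1K, p2K) subr0.
exists (pair_code 0 (pair_code n.+1 d)).
by rewrite rat_of_codeE /rnum /rden !(p1K, p2K) sub0r NegzE mulrNz.
Qed.

Lemma rat_of_code_dense : dense (range (rat_of_code R : nat -> R^o)).
Proof.
move=> O O0 oO; have [z [Oz [q _ qz]]] := @dense_rat R O O0 oO.
have [r rq] := rat_of_code_surj q.
by exists z; split=> //; exists r => //; rewrite rq.
Qed.

Lemma rat_of_code_dist : computable_double_seq
  (fun n m => mdist (rat_of_code R n : R^o) (rat_of_code R m)).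
Proof.
exists (fun w => rat_abs (rat_add (p1 (p2 w)) (rat_opp (p1 w)))).
  by apply: prim_computable; apply: prim_rat_abs; apply: prim_rat_add;
    [|apply: prim_rat_opp]; prim.
move=> n m k; rewrite !(p1K, p2K) rat_absE rat_addE rat_oppE.
by rewrite /mdist /= subrr normr0 ltW // expV2_gt0.
Qed.

Definition real_cms : computable_metric_space R :=
  ComputableMetricSpace rat_of_code_dense rat_of_code_dist.

(** Since [0 = <0, <0, 0>>] and [1 = <1, <0, 0>>], the constant streams written by [limit_machine]
    already name the reals 0 and 1. *)
Lemma rat_of_code_bool (b : bool) : rat_of_code R b = b%:R.
Proof. by case: b; rewrite rat_of_codeE /rnum /rden /= subr0 divr1. Qed.

Lemma const_name (b : bool) : @cauchy_name R real_cms (fun=> b) (b%:R : R^o).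
Proof.
split=> [k n _|]; first by rewrite mdistxx expV2_gt0.
by rewrite /= rat_of_code_bool; exact: cvg_cst.
Qed.

End Reals.

Section Indicator.
Variables (R : realType) (X : computable_metric_space R).

Notation alpha := (cms_seq X).

Lemma ce_open_detect i : exists2 f, prim f & forall p (y : X), cauchy_name p y ->
  (ce_open X i y <-> exists k s, f (pair_code (pair_code k (p k)) s) <> 0%N).
Proof.
have [g cg gP] := cms_computable X.
(* One [2^-k] pays for the error of [g], the other for the distance from [alpha (p k)] to the named
   point. *)
pose near w n v := rat_lt (rat_add (rat_add v (rat_pow (p1 w))) (rat_pow (p1 w))) (p2 n).
pose hit w n := W i n /\ exists v,
  v = g (pair_code (p2 w) (pair_code (p1 n) (p1 w))) /\ near w n v.
have [f pf fP] : sig1 (fun w => exists n, hit w n).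
  apply: sig1_ex; apply: sig1_and; first by apply: sig1_comp (sig1_W_index i) _; prim.
  apply: (sig1_ex (P := fun u v => v = g (pair_code (p2 (p1 u))
    (pair_code (p1 (p2 u)) (p1 (p1 u)))) /\ near (p1 u) (p2 u) v)).
  apply: sig1_and; first by apply: sig1_graph_comp; prim.
  apply: sig1_prim; apply: prim_rat_lt; prim.
  by do 2?apply: prim_rat_add; try apply: prim_rat_pow; prim.
exists f => // p y py; split=> [[n Wn]|[k [s]] fk]; last first.
  have [n [Wn [v [vE]]]] : exists n, hit (pair_code k (p k)) n by apply/fP; exists s.
  rewrite /near (rat_ltE R) !rat_addE rat_powE vE !(p1K, p2K) => lt_r.
  exists n => //; rewrite /rational_ball of_natE /=.
  have := gP (p k) (p1 n) k; rewrite ler_norml => /andP[_].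
  have := cauchy_name_dist k py; rewrite metric_sym.
  have := metric_triangle y (alpha (p k)) (alpha (p1 n)).
  lra.
rewrite /rational_ball of_natE /= => yn.
(* Besides the two margins in [near], the same two errors occur again when [v] is bounded by the
   distance from [y]; hence the 4. *)
have [k kP] := @expV2_lt R ((rat_of_code R (p2 n) - mdist y (alpha (p1 n))) / 4)
  ltac:(by rewrite divr_gt0 // subr_gt0).
suff [s fs] : exists s, f (pair_code (pair_code k (p k)) s) <> 0%N by exists k, s.
apply/fP; exists n; split=> //; eexists; split; first by [].
rewrite /near (rat_ltE R) !rat_addE rat_powE !(p1K, p2K).
have := gP (p k) (p1 n) k; rewrite ler_norml => /andP[+ _].
have := cauchy_name_dist k py.
have := metric_triangle (alpha (p k)) y (alpha (p1 n)).
lra.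
Qed.

Lemma limit_computable_indicator i :
  limit_computable [set: X] (fun y => (`[< ce_open X i y >] : bool)%:R : real_cms R).
Proof.
have [f pf fP] := ce_open_detect i; have [M HM] := limit_machine pf.
exists setT, (fun p _ => `[< exists k s, f (pair_code (pair_code k (p k)) s) <> 0%N >] : nat).
split=> [|p y py _]; first by exists M => p _ n; exact: HM.
split=> //; have -> : `[< ce_open X i y >] =
  `[< exists k s, f (pair_code (pair_code k (p k)) s) <> 0%N >].
  by apply: asbool_equiv_eq; exact: fP.
exact: const_name.
Qed.

Lemma continuous_one_generic (x : X) :
  (forall (Y : computable_metric_space R) (D : set X) (f : X -> Y),
     limit_computable D f -> D x -> {for x, continuous (f : subspace D -> Y)}) ->
  one_generic x.
Proof.
move=> H; apply/one_genericP => i.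
(* Distinct values of the indicator are at distance 1, so [e = 1] forces equality. *)
have /(continuous_subspace_mdistP _ (I : [set: X] x)) /(_ 1 ltr01)[d d0 dP] :=
  H _ _ _ (limit_computable_indicator i) I.
exists d => // y /(dP y I); rewrite /mdist /=.
case: asboolP => yU; case: asboolP => xU; rewrite ?subr0 ?sub0r ?normrN ?normr1 ?ltxx //.
Qed.

End Indicator.

(** * Stable names *)

Definition agree (p q : nat -> nat) (t : nat) : Prop := forall k, (k <= t)%N -> p k = q k.

Lemma agree_trans p q r t : agree p q t -> agree q r t -> agree p r t.
Proof. by move=> pq qr k kt; rewrite pq ?qr. Qed.

Lemma agree_le p q t u : (u <= t)%N -> agree p q t -> agree p q u.
Proof. by move=> ut pq k ku; apply: pq; exact: leq_trans ut. Qed.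

Lemma agree_splice p q t : agree p (fun k => if (k <= t)%N then p k else q k) t.
Proof. by move=> k kt; rewrite kt. Qed.

Lemma agree_snth p t : agree p (snth (lenc (mkseq p t.+1))) t.
Proof. by move=> k kt; rewrite snth_lenc nth_mkseq. Qed.

(** Each block has at least one cell, so cell [t] depends on the entries up to [t] only. *)
Lemma agree_baire_tape p q t : agree p q t -> baire_tape p t = baire_tape q t.
Proof.
move=> pq; rewrite /baire_tape; congr (Some (~~ _)); apply: eq_existsb => n.
congr (_ == _); apply: eq_bigr => i _; rewrite pq //.
by have := ltn_ord i; have := ltn_ord n; lia.
Qed.

Lemma in_head_run M inp t : (in_head (run M inp t) <= t)%N.
Proof.
elim: t => [//|t]; rewrite /run iterS -/(run M inp t) /step.
case: (tagged M _) => [[[[s m] ws] o]|] /=; last exact: leqW.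
by case: m => /=; lia.
Qed.

Lemma agree_run M p q t : agree p q t ->
  run M (baire_tape p) t = run M (baire_tape q) t.
Proof.
elim: t => [//|t IH] pq; rewrite /run !iterS -/(run M _ t) -/(run M (baire_tape q) t).
rewrite -IH; last exact: agree_le pq.
rewrite /step (agree_baire_tape (q := q)) //; apply: agree_le pq.
exact: leqW (in_head_run _ _ _).
Qed.

(** At the first difference, the 0 closing the shorter block faces a 1 of the other stream, in a
    cell within the blocks of [p]. *)
Lemma baire_tape_determines p q N :
  (forall j, (j < block_start p N.+1)%N -> baire_tape p j = baire_tape q j) -> agree p q N.
Proof.
move=> H; elim/ltn_ind => m IH mN.
have bs : block_start p m = block_start q m.
  by apply: eq_bigr => i _; rewrite IH // ltnW // (leq_trans (ltn_ord i)).
have bN := block_start_mono p (mN : (m.+1 <= N.+1)%N); rewrite block_startS in bN.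
have [pq|qp|//] := ltngtP (p m) (q m).
  have /H : (block_start p m + p m < block_start p N.+1)%N by lia.
  by rewrite baire_tape0 bs baire_tape1.
have /H : (block_start p m + q m < block_start p N.+1)%N by lia.
by rewrite baire_tape1 // bs baire_tape0.
Qed.

Section Generic.
Variables (R : realType) (X : computable_metric_space R) (x : X) (M : turing_machine).

Notation alpha := (cms_seq X).
Notation outc p t j := (cells (out (run M (baire_tape p) t)) j).

Lemma agree_outc p q t u j : agree p q t -> (u <= t)%N -> outc p u j = outc q u j.
Proof. by move=> pq ut; rewrite (agree_run M (agree_le ut pq)). Qed.

Lemma tight_name_ex (y : X) : exists p, tight_name p y.
Proof.
have H k : exists c, mdist y (alpha c) < 2 ^- k.+1 by apply: seq_near; exact: expV2_gt0.
by have [p pP] := choice H; exists p.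
Qed.

Lemma tight_splice p q t (y : X) : tight_prefix p t y -> tight_name q y ->
  tight_name (fun k => if (k <= t)%N then p k else q k) y.
Proof. by move=> py qy k; case: ifP => kt; [exact: py|exact: qy]. Qed.

Hypothesis converges : forall p, tight_name p x ->
  exists q : nat -> symb, forall j, exists T, forall t, (T <= t)%N -> outc p t j = q j.

Lemma converges_prefix p L : tight_name p x ->
  exists T, forall t u j, (T <= t)%N -> (T <= u)%N -> (j < L)%N -> outc p t j = outc p u j.
Proof.
move=> /converges[q qP]; have [T TP] := choice qP.
exists (\max_(j < L) T j) => t u j Tt Tu jL.
have Tj : (T j <= \max_(j < L) T j)%N by exact: (@leq_bigmax _ (fun j : 'I_L => T j) (Ordinal jL)).
by rewrite !TP // (leq_trans Tj).
Qed.

(* Baire category argument: at every stage, whenever some name of [x] extending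
   the current prefix makes [M] change one of its first [L] output cells, move to
   it. The limit is a name of [x], so for every [L] this happens only finitely
   often, after which no extension can change these cells. *)
Lemma stable_name : exists2 p, tight_name p x & forall L, exists t0,
  forall q, tight_name q x -> agree p q t0 ->
  forall t j, (t0 <= t)%N -> (j < L)%N -> outc q t j = outc p t0 j.
Proof.
(* Through the pairing in [p1 i] every [L] is treated at arbitrarily late stages. The premise on
   [s.1] lets [next] be total. *)
pose good i (s s' : (nat -> nat) * nat) := tight_name s.1 x ->
  [/\ tight_name s'.1 x, agree s.1 s'.1 s.2, (s.2 < s'.2)%N &
   (exists u j, [/\ (s.2 <= u)%N, (u <= s'.2)%N, (j < p1 i)%N & outc s'.1 u j <> outc s.1 s.2 j])
   \/ (forall q, tight_name q x -> agree s.1 q s.2 ->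
        forall u j, (s.2 <= u)%N -> (j < p1 i)%N -> outc q u j = outc s.1 s.2 j)].
have [next nextP] : exists next, forall z, good z.1 z.2 (next z).
  suff H z : exists s', good z.1 z.2 s' by have [next ?] := choice H; exists next.
  case: z => i [p t] /=.
  have [[q [u [j [qx pq tu [jL qu]]]]]|nq] := pselect (exists q u j,
      [/\ tight_name q x, agree p q t, (t <= u)%N & (j < p1 i)%N /\ outc q u j <> outc p t j]).
    (* By time [u] the machine has used only this prefix, so the change persists on every extension
       of it. *)
    exists (q, u.+1) => px; split=> //=; left; exists u, j; split=> //; exact: ltnW.
  exists (p, t.+1) => px; split=> //=; right=> q qx pq u j tu jL.
  by apply: contrapT => qu; apply: nq; exists q, u, j.
have [q0 q0x] := tight_name_ex x.
pose S := fix S i := if i is k.+1 then next (k, S k) else (q0, 0%N).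
have Sx i : tight_name (S i).1 x.
  by elim: i => [//|i IH]; have [] := nextP (i, S i) IH.
have Sle i j : (i <= j)%N -> agree (S i).1 (S j).1 (S i).2 /\ ((S i).2 <= (S j).2)%N.
  move=> /subnK <-; elim: (j - i)%N => [//|d [IH1 IH2]].
  have [_ /= ag lt _] := nextP (d + i, S (d + i)%N) (Sx _).
  split; last exact: leq_trans IH2 (ltnW lt).
  exact: agree_trans IH1 (agree_le IH2 ag).
have Si i : (i <= (S i).2)%N.
  elim: i => [//|i IH]; have [_ _ /= lt _] := nextP (i, S i) (Sx _).
  exact: leq_ltn_trans IH lt.
pose p k := (S k).1 k.
have Sp i : agree (S i).1 p (S i).2.
  move=> k ki; rewrite /p; have [ik|/ltnW ki'] := leqP i k.
    by have [-> //] := Sle _ _ ik.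
  by have [-> //] := Sle _ _ ki'.
have px : tight_name p x by move=> k; exact: Sx.
exists p => // L; have [T TP] := converges_prefix L px.
(* A stage devoted to [L] with [i >= T]: its prefix length exceeds the time after which the first
   [L] cells are constant on [p]. *)
pose i := pair_code L T.
have Ti : (T <= (S i).2)%N.
  apply: leq_trans (Si i); have := Cantor.to_nat_non_decreasing L T.
  by rewrite -/(pair_code L T) -/i; lia.
(* A change made at this stage would occur on [p] itself, which extends the prefix of the next
   stage, and after time [T]. *)
have [_ _ _ /= [[u [j [Su uS jL]]]|st]] := nextP (i, S i) (Sx _).
  case; rewrite -[next _]/(S i.+1) (agree_outc j (Sp i.+1) uS).
  rewrite (agree_outc j (Sp i) (leqnn _)); rewrite p1K in jL.
  by apply: TP => //; exact: leq_trans Su.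
exists (S i).2 => q qx pq t j it jL.
rewrite -(agree_outc j (Sp i) (leqnn _)); apply: st => //; last by rewrite p1K.
exact: agree_trans (Sp i) pq.
Qed.

End Generic.

(** * Genericity implies continuity *)

Section Forward.
Variables (R : realType) (X : computable_metric_space R).

Notation alpha := (cms_seq X).
Notation outc M p t j := (cells (out (run M (baire_tape p) t)) j).

(** Finitely many strict inequalities have a common slack, so tightness of a prefix is an open
    condition on the point. *)
Lemma tight_prefix_slack p t (y : X) : tight_prefix p t y ->
  exists2 e : R, 0 < e & forall k, (k <= t)%N -> mdist y (alpha (p k)) + e <= 2 ^- k.+1.
Proof.
elim: t => [|t IH] py.
  exists (2 ^- 1 - mdist y (alpha (p 0%N))); first by rewrite subr_gt0 py.
  by move=> k; rewrite leqn0 => /eqP ->; rewrite subrKC.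
have [|e e0 He] := IH; first by move=> k kt; apply: py; exact: leqW.
exists (Num.min e (2 ^- t.+2 - mdist y (alpha (p t.+1)))).
  by rewrite lt_min e0 subr_gt0 py.
move=> k; rewrite leq_eqVlt => /orP[/eqP ->|kt].
  by rewrite -lerBrDl ge_min lexx orbT.
by apply: le_trans (He k kt); rewrite lerD2l ge_min lexx.
Qed.

(* The balls [B_<c,r>] for which the stage [2^-m] approximations of distances
   show that [snth l] up to [t] is a prefix of a tight name of all their points,
   and on this prefix [M] changes an output cell after time [t0]. *)
Definition mind_change_ball (g : nat -> nat) (M : turing_machine) (t0 L w vs n u : nat) :=
  let l := p1 u in let t := p1 (p2 u) in let j := p1 (p2 (p2 u)) in
  let m := p2 (p2 (p2 u)) in
  [/\ (t0 <= t)%N, (j < L)%N, scode (outc M (snth l) t j) <> snth vs j,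
      forall k, (k < t0.+1)%N -> snth l k = snth w k &
      forall k, (k < t.+1)%N -> exists v,
        v = g (pair_code (p1 n) (pair_code (snth l k) m)) /\
        rat_lt (rat_add (rat_add v (rat_pow m)) (p2 n)) (rat_pow k.+1)].

Lemma sig1_mind_change g M t0 L w vs : computable_nat g ->
  sig1 (fun n => exists u, mind_change_ball g M t0 L w vs n u).
Proof.
move=> cg; apply: (sig1_ex (P := mind_change_ball g M t0 L w vs)).
pose l z := p1 (p2 z); pose t z := p1 (p2 (p2 z)); pose j z := p1 (p2 (p2 (p2 z))).
pose m z := p2 (p2 (p2 (p2 z))).
have pl : prim l by rewrite /l; prim.
have pt : prim t by rewrite /t; prim.
have pj : prim j by rewrite /j; prim.
have pm : prim m by rewrite /m; prim.
pose b z := [&& (t0 <= t z)%N, (j z < L)%N & scode (outc M (snth (l z)) (t z) (j z)) != snth vs (j z)].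
have sb : sig1 b.
  apply: sig1_prim; rewrite /b; apply: prim_andb; first by prim.
  apply: prim_andb; first by prim.
  apply: prim_neg; apply: prim_eqn; last by apply: prim_snth; prim.
  exact: (@prim_out M (fun l => baire_tape (snth l)) prim_baire_tape _ _ _ pl pt pj).
have sw : sig1 (fun z => forall k, (k < t0.+1)%N -> snth (l z) k = snth w k).
  apply: sig1_all; first by prim.
  apply: sig1_iff (@sig1_prim (fun z => snth (l (p1 z)) (p2 z) == snth w (p2 z)) _).
    by move=> z; split=> /eqP.
  by apply: prim_eqn; apply: prim_snth; prim.
have sg : sig1 (fun z => forall k, (k < (t z).+1)%N -> exists v,
    v = g (pair_code (p1 (p1 z)) (pair_code (snth (l z) k) (m z))) /\
    rat_lt (rat_add (rat_add v (rat_pow (m z))) (p2 (p1 z))) (rat_pow k.+1)).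
  apply: sig1_all; first by prim.
  apply: (sig1_ex (P := fun z v =>
    v = g (pair_code (p1 (p1 (p1 z))) (pair_code (snth (l (p1 z)) (p2 z)) (m (p1 z)))) /\
    rat_lt (rat_add (rat_add v (rat_pow (m (p1 z)))) (p2 (p1 (p1 z)))) (rat_pow (p2 z).+1))).
  apply: sig1_and.
    by apply: sig1_graph_comp; prim; apply: prim_snth; prim.
  apply: sig1_prim; apply: prim_rat_lt; last by apply: prim_rat_pow; prim.
  by do 2?apply: prim_rat_add; try apply: prim_rat_pow; prim.
apply: sig1_iff (sig1_and sb (sig1_and sw sg)) => z; rewrite /b.
split=> [[/and3P[? ? /eqP ?] []]|[? ? ? ? ?]]; first by split.
by do !split=> //; apply/and3P; split=> //; apply/eqP.
Qed.

Lemma one_generic_continuous (x : X) (Y : computable_metric_space R) (D : set X)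
    (f : X -> Y) : one_generic x -> limit_computable D f -> D x ->
  {for x, continuous (f : subspace D -> Y)}.
Proof.
move=> /one_genericP gx [E [F [[M HM] HF]]] Dx.
apply/(continuous_subspace_mdistP _ Dx) => e e0.
have tightF p y : D y -> tight_name p y -> E p /\ cauchy_name (F p) (f y).
  by move=> Dy /tight_name_cauchy /HF /(_ Dy).
have tightM p y : D y -> tight_name p y -> forall j, exists T, forall t, (T <= t)%N ->
    outc M p t j = baire_tape (F p) j.
  by move=> Dy py; apply: HM; have [] := tightF _ _ Dy py.
have [p px stable] : exists2 p, tight_name p x & forall L, exists t0,
    forall q, tight_name q x -> agree p q t0 ->
    forall t j, (t0 <= t)%N -> (j < L)%N -> outc M q t j = outc M p t0 j.
  by apply: stable_name => p px; exists (baire_tape (F p)); exact: tightM Dx px.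
have [N Ne] : exists N, 2 ^- N < e / 2 by apply: expV2_lt; rewrite divr_gt0.
(* These cells hold the entries up to [N]. Points whose names share entry [N] are at most [2 * 2^-N]
   apart, which is less than [e]. *)
pose L := block_start (F p) N.+1.
have [t0 Ht0] := stable L.
have out_t0 j : (j < L)%N -> outc M p t0 j = baire_tape (F p) j.
  move=> jL; have [T HT] := tightM _ _ Dx px j.
  rewrite -(HT (maxn T t0)) ?leq_maxl // (Ht0 p) // leq_maxr //.
pose w := lenc (mkseq p t0.+1).
pose vs := lenc (mkseq (fun j => scode (outc M p t0 j)) L).
have [g cg gP] := cms_computable X.
have [i Wi] := sig1_W (@sig1_mind_change g M t0 L w vs cg).
have xU : ~ ce_open X i x.
  case=> n /Wi[u [tu jL out_ne wl ball]]; rewrite /rational_ball of_natE /= => xn.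
  set l := p1 u in out_ne wl ball; set t := p1 (p2 u) in tu out_ne ball.
  set j := p1 (p2 (p2 u)) in jL out_ne; set m := p2 (p2 (p2 u)) in ball.
  have lx : tight_prefix (snth l) t x.
    move=> k kt; have [v [vE]] := ball k kt.
    rewrite (rat_ltE R) !rat_addE !rat_powE vE.
    have := gP (p1 n) (snth l k) m; rewrite ler_norml => /andP[_].
    have := metric_triangle x (alpha (p1 n)) (alpha (snth l k)).
    lra.
  (* The prefix supplied by the ball agrees with [p] up to [t0]; continued by [p] it becomes a tight
     name of [x], on which stability forbids the change. *)
  have qx := tight_splice lx px.
  have lq := @agree_splice (snth l) p t.
  have pq : agree p (fun k => if (k <= t)%N then snth l k else p k) t0.
    apply: agree_trans (agree_le tu lq) => k kt0.
    by rewrite wl // snth_lenc nth_mkseq.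
  apply: out_ne; rewrite snth_lenc nth_mkseq //; congr scode.
  by rewrite (agree_outc M j lq (leqnn t)); exact: Ht0.
have [d1 d10 d1P] := gx i.
have [d2 d20 d2P] := @tight_prefix_slack p t0 x (fun k _ => px k).
exists (Num.min d1 d2); first by rewrite lt_min d10.
move=> y Dy; rewrite lt_min => /andP[/d1P yU yd2].
have {}yU : ~ ce_open X i y by move/yU.
rewrite ltNge; apply/negP => fxy; apply: yU.
have [p' p'y] := tight_name_ex y.
have py : tight_prefix p t0 y.
  move=> k kt0; have := d2P k kt0.
  have := metric_triangle y x (alpha (p k)); rewrite (metric_sym y x); lra.
have qy := tight_splice py p'y; set q := (fun k => _) in qy.
have pq : agree p q t0 by exact: agree_splice.
(* Otherwise both output names share entry [N], and [f y] is too close to [f x]. *)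
have [j jL jne] : exists2 j, (j < L)%N & baire_tape (F p) j <> baire_tape (F q) j.
  apply: contrapT => nj.
  have FN : agree (F p) (F q) N.
    by apply: baire_tape_determines => j jL; apply: contrapT => ?; apply: nj; exists j.
  have [_ /(cauchy_name_dist N)] := tightF _ _ Dx px.
  have [_ /(cauchy_name_dist N)] := tightF _ _ Dy qy.
  rewrite -FN // => yN; rewrite metric_sym => xN.
  have := metric_triangle (f x) (cms_seq Y (F p N)) (f y); lra.
have [T HT] := tightM _ _ Dy qy j.
(* At time [t] cell [j] has its final value on [q], unlike its value at [t0]: a late change, visible
   on the finite prefix [l]. *)
pose t := maxn T t0; pose l := lenc (mkseq q t.+1).
have ql : agree q (snth l) t by exact: agree_snth.
have [s s0 sP] := @tight_prefix_slack q t y (fun k _ => qy k).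
(* The slack has to absorb the error of [g], the margin in the test, the radius of the ball and the
   distance from [y] to its centre, each at most [2^-m]. *)
have [m ms] : exists m, 2 ^- m < s / 4 by apply: expV2_lt; rewrite divr_gt0.
have [c yc] := seq_near y (expV2_gt0 R m).
exists (pair_code c (rat_pow m)); last by rewrite /rational_ball of_natE /= p1K p2K rat_powE.
apply/Wi; exists (pair_code l (pair_code t (pair_code j m))).
rewrite /mind_change_ball !(p1K, p2K); split=> //.
- exact: leq_maxr.
- rewrite snth_lenc nth_mkseq // => /scode_inj.
  rewrite -(agree_outc M j ql (leqnn t)) HT ?leq_maxl // out_t0 // => /esym; exact: jne.
- move=> k kt0; rewrite -(ql k) ?(leq_trans _ (leq_maxr T t0)) //.
  by rewrite snth_lenc nth_mkseq // -(pq k).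
- move=> k kt; eexists; split; first by [].
  rewrite (rat_ltE R) !rat_addE !rat_powE.
  have := gP c (snth l k) m; rewrite ler_norml => /andP[+ _].
  have := sP k kt; rewrite (ql k kt).
  have := metric_triangle (alpha c) y (alpha (snth l k)); rewrite (metric_sym _ y).
  lra.
Qed.

End Forward.

Theorem theorem5p17 (R : realType) (X : computable_metric_space R) (x : X) :
  one_generic x <->
  (forall (Y : computable_metric_space R) (D : set X) (f : X -> Y),
     limit_computable D f -> D x ->
     {for x, continuous (f : subspace D -> Y)}).
Proof.
split; last exact: continuous_one_generic.
by move=> gx Y D f; exact: one_generic_continuous.
Qed.
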